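(* Let $\mathcal{R}$ be the Ruperthedron defined in the context. Then: (1) $\mathcal{R}$ has Rupert's property and its Nieuwland number is at least $1.003$; (2) there is no $(\theta_1,\varphi_1,\theta_2,\varphi_2,\alpha)\in\mathbb{R}^5$ with $|\theta_1-\theta_2|,|\varphi_1-\varphi_2|,|\alpha|\le 0.0006$ such that $R(\alpha)M(\theta_1,\varphi_1)\mathcal{R}\subset\operatorname{int}\operatorname{conv}(M(\theta_2,\varphi_2)\mathcal{R})$. In particular, $\mathcal{R}$ has Rupert's property but is not locally Rupert.
   Context: For $\alpha,\theta,\varphi\in\mathbb{R}$ let $R(\alpha)=\begin{pmatrix}\cos\alpha&-\sin\alpha\\ \sin\alpha&\cos\alpha\end{pmatrix}$ and $M(\theta,\varphi)=\begin{pmatrix}-\sin\theta&\cos\theta&0\\ -\cos\theta\cos\varphi&-\sin\theta\cos\varphi&\sin\varphi\end{pmatrix}$; matrices act on finite point sets elementwise. A pointsymmetric polyhedron (finite non-degenerate set $\mathcal{P}\subset\mathbb{R}^3$ in convex position with $\mathcal{P}=-\mathcal{P}$) has Rupert's property if there exist $\theta_1,\theta_2\in[0,2\pi)$, $\varphi_1,\varphi_2\in[0,\pi]$, $\alpha\in[-\pi,\pi)$ with $R(\alpha)M(\theta_1,\varphi_1)\mathcal{P}\subset\operatorname{int}\operatorname{conv}(M(\theta_2,\varphi_2)\mathcal{P})$ (such a tuple is called a solution to Rupert's condition). Its Nieuwland number is the supremum of all $s>0$ for which there exist such parameters with $s\,R(\alpha)M(\theta_1,\varphi_1)\mathcal{P}\subset\operatorname{int}\operatorname{conv}(M(\theta_2,\varphi_2)\mathcal{P})$.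 $\mathcal{P}$ is locally Rupert if for every $\varepsilon>0$ there is a solution to Rupert's condition with $|\theta_1-\theta_2|,|\varphi_1-\varphi_2|,|\alpha|\le\varepsilon$. Let $R_z(\beta)=\begin{pmatrix}\cos\beta&-\sin\beta&0\\ \sin\beta&\cos\beta&0\\0&0&1\end{pmatrix}$, $\mathcal{C}_{30}=\{(-1)^\ell R_z(2\pi k/15): k=0,\dots,14,\ \ell=0,1\}$, and $D_1=\frac{1}{5861}(3939,0,4340)^t$, $D_2=10^{-4}(7855,4178,4484)^t$, $D_3=10^{-4}(9526,2057,1102)^t$. The Ruperthedron is $\mathcal{R}=\mathcal{C}_{30}D_1\cup\mathcal{C}_{30}D_2\cup\mathcal{C}_{30}D_3$. *)

(* Defs.v *)
From Stdlib Require Import Reals List.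
From Coquelicot Require Import Coquelicot.
Import ListNotations.
Open Scope R_scope.

Definition pt3 := (R * R * R)%type.
Definition pt2 := (R * R)%type.

Definition Rot (a : R) (p : pt2) : pt2 :=
  let '(u, v) := p in (cos a * u - sin a * v, sin a * u + cos a * v).

Definition Mproj (th ph : R) (p : pt3) : pt2 :=
  let '(x, y, z) := p in
  (- sin th * x + cos th * y,
   - cos th * cos ph * x - sin th * cos ph * y + sin ph * z).

Definition scale2 (s : R) (p : pt2) : pt2 := let '(u, v) := p in (s * u, s * v).

Definition Rz (b : R) (p : pt3) : pt3 :=
  let '(x, y, z) := p in (cos b * x - sin b * y, sin b * x + cos b * y, z).
Definition neg3 (p : pt3) : pt3 := let '(x, y, z) := p in (- x, - y, - z).

Definition C30_orbit (d : pt3) : list pt3 :=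
  flat_map (fun k : nat =>
     let q := Rz (2 * PI * INR k / 15) d in [q; neg3 q]) (seq 0 15).

Definition D1 : pt3 := (3939 / 5861, 0, 4340 / 5861).
Definition D2 : pt3 := (7855 / 10000, 4178 / 10000, 4484 / 10000).
Definition D3 : pt3 := (9526 / 10000, 2057 / 10000, 1102 / 10000).

Definition Ruperthedron : list pt3 := C30_orbit D1 ++ C30_orbit D2 ++ C30_orbit D3.

Fixpoint wsum (w : list R) (Q : list pt2) : pt2 :=
  match w, Q with
  | a :: w', (u, v) :: Q' => let '(su, sv) := wsum w' Q' in (a * u + su, a * v + sv)
  | _, _ => (0, 0)
  end.

Definition in_conv (Q : list pt2) (x : pt2) : Prop :=
  exists w : list R, (length w = length Q)%nat /\ List.Forall (fun a => 0 <= a) w /\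
    fold_right Rplus 0 w = 1 /\ wsum w Q = x.

Definition in_int_conv (Q : list pt2) (x : pt2) : Prop :=
  exists e, 0 < e /\ forall y : pt2,
    (fst y - fst x) ^ 2 + (snd y - snd x) ^ 2 < e ^ 2 -> in_conv Q y.

Definition rupert_cond (P : list pt3) (s th1 ph1 th2 ph2 a : R) : Prop :=
  forall p, In p P ->
    in_int_conv (map (Mproj th2 ph2) P) (scale2 s (Rot a (Mproj th1 ph1 p))).

Definition param_range (th1 ph1 th2 ph2 a : R) : Prop :=
  0 <= th1 < 2 * PI /\ 0 <= th2 < 2 * PI /\
  0 <= ph1 <= PI /\ 0 <= ph2 <= PI /\ - PI <= a < PI.

Definition has_rupert_property (P : list pt3) : Prop :=
  exists th1 ph1 th2 ph2 a, param_range th1 ph1 th2 ph2 a /\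
    rupert_cond P 1 th1 ph1 th2 ph2 a.

Definition nieuwland_number (P : list pt3) : Rbar :=
  Lub_Rbar (fun s => 0 < s /\ exists th1 ph1 th2 ph2 a,
     param_range th1 ph1 th2 ph2 a /\ rupert_cond P s th1 ph1 th2 ph2 a).

Definition locally_rupert (P : list pt3) : Prop :=
  forall eps, 0 < eps -> exists th1 ph1 th2 ph2 a,
    param_range th1 ph1 th2 ph2 a /\ rupert_cond P 1 th1 ph1 th2 ph2 a /\
    Rabs (th1 - th2) <= eps /\ Rabs (ph1 - ph2) <= eps /\ Rabs a <= eps.

(* Main.v *)
Require Import Defs.
From Stdlib Require Import Reals List ZArith Bool Lra Lia Psatz.
From Coquelicot Require Import Coquelicot.
Import ListNotations.
Open Scope R_scope.

(** Write [X] for the direction of projection [view th ph], so that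
    [<M p, M q> = <p, q> - <X, p> <X, q>].

    Suppose that [v] is a vertex whose projection along [X2] is, with some margin, a
    local maximum of the distance to the origin on the projected polyhedron. If the
    parameters change by at most [0.0006], then [R(a) M1 v] is so close to [M2 v] that
    lying in the interior of the projected polyhedron forces [|M1 v| < |M2 v|], that is
    [<X1, v> > <X2, v>]. If [X2 = m1 v1 + m2 v2 + m3 v3] with [m_i >= 0] and such
    vertices [v_i], then [<X1, X2> > <X2, X2> = 1], which is absurd for unit vectors.
    That every direction [X2] is such a combination is invariant under the 30 symmetries;
    on a fundamental sector it is checked by bisecting a spherical triangle,
    with exact integer arithmetic on rounded vertices.

    For the passage itself, explicit angles with rational tangents of their halves are
    given, and each inner point is located well inside a triangle of outer points. *)

(** * Rounded vertices *)

(** Since [|M v|^2 = |v|^2 - <X, v>^2], comparing the lengths of [M1 v] and [M2 v] compares only the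
    squares of [<X1, v>] and [<X2, v>]. The bound [<X2, v> >= 9 / 20000] excludes the wrong sign,
    because the direction moves by at most [sqrt 2 * 0.0006], which is less than twice that bound.
    The margin [41 / 50000] comes from the distance between [R(a) M1 v] and [M2 v], which is at most
    [(1 + sqrt 3) * 0.0006], just below twice the margin.

    The difficulty of the finite check is that it must hold for all unit vectors of a triangle
    without square roots. Three substitutes turn every test into an integer inequality:
    [4 |w|^2 + 1 / 16] for [|w|], the sum of the coordinates for the norm of [X] (the sector lies in
    the positive octant), and the least entry of the Gram matrix of the corners for the
    normalisation of the weights. Each test has a margin that exceeds the rounding error of the
    vertices. *)

(* The points of [Ruperthedron], in the same order, multiplied by [10 ^ 6] and rounded. *)
Definition vertsZ : list (Z * Z * Z) :=
  [(672070, 0, 740488); (-672070, 0, -740488); (613966, 273355, 740488);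
   (-613966, -273355, -740488); (449702, 499445, 740488); (-449702, -499445, -740488);
   (207681, 639176, 740488); (-207681, -639176, -740488); (-70250, 668388, 740488);
   (70250, -668388, -740488); (-336035, 582029, 740488); (336035, -582029, -740488);
   (-543716, 395033, 740488); (543716, -395033, -740488); (-657383, 139731, 740488);
   (657383, -139731, -740488); (-657383, -139731, 740488); (657383, 139731, -740488);
   (-543716, -395033, 740488); (543716, 395033, -740488); (-336035, -582029, 740488);
   (336035, 582029, -740488); (-70250, -668388, 740488); (70250, 668388, -740488);
   (207681, -639176, 740488); (-207681, 639176, -740488); (449702, -499445, 740488);
   (-449702, 499445, -740488); (613966, -273355, 740488); (-613966, 273355, -740488);
   (785500, 417800, 448400); (-785500, -417800, -448400); (547655, 701171, 448400);
   (-547655, -701171, -448400); (215116, 863303, 448400); (-215116, -863303, -448400);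
   (-154619, 876162, 448400); (154619, -876162, -448400); (-497618, 737525, 448400);
   (497618, -737525, -448400); (-754575, 471363, 448400); (754575, -471363, -448400);
   (-881060, 123698, 448400); (881060, -123698, -448400); (-855200, -245355, 448400);
   (855200, 245355, -448400); (-681469, -571985, 448400); (681469, 571985, -448400);
   (-389906, -799713, 448400); (389906, 799713, -448400); (-30925, -889163, 448400);
   (30925, 889163, -448400); (333404, -824869, 448400); (-333404, 824869, -448400);
   (640084, -617948, 448400); (-640084, 617948, -448400); (836088, -304177, 448400);
   (-836088, 304177, -448400); (887525, 62188, 448400); (-887525, -62188, -448400);
   (952600, 205700, 110200); (-952600, -205700, -110200); (786578, 575374, 110200);
   (-786578, -575374, -110200); (484549, 845560, 110200); (-484549, -845560, -110200);
   (98737, 969541, 110200); (-98737, -969541, -110200); (-304147, 925880, 110200);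
   (304147, -925880, -110200); (-654441, 722126, 110200); (654441, -722126, -110200);
   (-891577, 393509, 110200); (891577, -393509, -110200); (-974551, -3148, 110200);
   (974551, 3148, -110200); (-889016, -399262, 110200); (889016, 399262, -110200);
   (-649762, -726339, 110200); (649762, 726339, -110200); (-298159, -927826, 110200);
   (298159, 927826, -110200); (104999, -968883, 110200); (-104999, 968883, -110200);
   (490002, -842412, 110200); (-490002, 842412, -110200); (790279, -570280, 110200);
   (-790279, 570280, -110200); (953909, -199541, 110200); (-953909, 199541, -110200)]%Z.

(* [10 ^ 12 * cos (2 PI k / 15)] and [10 ^ 12 * sin (2 PI k / 15)], rounded. *)
Definition trigZ : list (Z * Z) :=
  [(1000000000000, 0);
   (913545457643, 406736643076);
   (669130606359, 743144825477);
   (309016994375, 951056516295);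
   (-104528463268, 994521895368);
   (-500000000000, 866025403784);
   (-809016994375, 587785252292);
   (-978147600734, 207911690818);
   (-978147600734, -207911690818);
   (-809016994375, -587785252292);
   (-500000000000, -866025403784);
   (-104528463268, -994521895368);
   (309016994375, -951056516295);
   (669130606359, -743144825477);
   (913545457643, -406736643076)]%Z.

Lemma approx_mul (x a y b e f A B : R) :
  Rabs (x - a) <= e -> Rabs (y - b) <= f -> Rabs a <= A -> Rabs y <= B ->
  Rabs (x * y - a * b) <= e * B + A * f.
Proof.
  intros Hx Hy Ha HB.
  replace (x * y - a * b) with ((x - a) * y + a * (y - b)) by ring.
  eapply Rle_trans; [apply Rabs_triang|].
  rewrite !Rabs_mult.
  apply Rplus_le_compat; apply Rmult_le_compat; auto using Rabs_pos.
Qed.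

(** The angle is 24 degrees, compared here with 30 degrees. The bound separates this root from the
    next one, [cos (4 PI / 15)], about 0.669, and starts an interval on which the quartic below is
    increasing. *)
Lemma cos_24_gt : 86 / 100 < cos (2 * PI / 15).
Proof.
  pose proof PI_RGT_0 as Hpi.
  assert (H : cos (PI / 6) < cos (2 * PI / 15)) by (apply cos_decreasing_1; lra).
  rewrite cos_PI6 in H.
  assert (0 <= sqrt 3) by apply sqrt_pos.
  assert (sqrt 3 * sqrt 3 = 3) by (apply sqrt_sqrt; lra).
  nra.
Qed.

(* [cos (2 PI / 15)] is the largest root of the quartic factor of [2 T_5 + 1],
   because [cos (5 * (2 PI / 15)) = - 1 / 2]. *)
Lemma cos_24_quartic (c := cos (2 * PI / 15)) :
  16 * c ^ 4 - 8 * c ^ 3 - 16 * c ^ 2 + 8 * c + 1 = 0.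
Proof.
  set (x := 2 * PI / 15) in c.
  pose proof PI_RGT_0 as Hpi.
  assert (Hc : 86 / 100 < c) by exact cos_24_gt.
  assert (H5 : cos (2 * x + (2 * x + x)) = - 1 / 2).
  { replace (2 * x + (2 * x + x)) with (2 * (PI / 3)) by (unfold x; field).
    rewrite cos_2PI3; lra. }
  rewrite cos_plus, (cos_plus (2 * x)), (sin_plus (2 * x)), cos_2a_cos, sin_2a in H5.
  pose proof (sin2_cos2 x) as H2. unfold Rsqr in H2. fold c in H2, H5.
  set (s := sin x) in *.
  assert (Hs : s * s = 1 - c * c) by lra.
  assert (H : (2 * c + 1) * (16 * c ^ 4 - 8 * c ^ 3 - 16 * c ^ 2 + 8 * c + 1) = 0).
  { match type of H5 with ?l = _ =>
      replace l with ((2 * c * c - 1) ^ 2 * c - (s * s) * (12 * c ^ 3 - 4 * c)) in H5 by ring end.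
    rewrite Hs in H5. lra. }
  apply Rmult_integral in H as [H | H]; lra.
Qed.

(** The quartic vanishes at [c] and increases near it, so its signs at two rationals [2 / 10 ^ 13]
    apart enclose [c]; the sine follows from [s * s = 1 - c * c]. *)
Lemma cos_24_bounds :
  Rabs (cos (2 * PI / 15) - 913545457643 / 10 ^ 12) <= / 10 ^ 12 /\
  Rabs (sin (2 * PI / 15) - 406736643076 / 10 ^ 12) <= / 10 ^ 12.
Proof.
  pose proof cos_24_quartic as Hq; cbv zeta in Hq.
  pose proof PI_RGT_0 as Hpi.
  set (c := cos (2 * PI / 15)) in *. set (s := sin (2 * PI / 15)).
  assert (Hc : 86 / 100 < c) by exact cos_24_gt.
  assert (Hs0 : 0 < s) by (apply sin_gt_0; lra).
  pose proof (sin2_cos2 (2 * PI / 15)) as H2. unfold Rsqr in H2. fold c s in H2.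
  assert (Hc1 : c <= 1) by apply COS_bound.
  (* The quartic [f] is increasing on [[0.86, 1]]: [f c - f t = (c - t) * g] with [g > 0]. *)
  assert (Hmono : forall t, 86 / 100 < t <= 1 ->
    0 < 16 * (c ^ 3 + c ^ 2 * t + c * t ^ 2 + t ^ 3) - 8 * (c ^ 2 + c * t + t ^ 2) - 16 * (c + t) + 8).
  { intros t Ht.
    assert (0 < (c - 86 / 100) * (t - 86 / 100)) by nra.
    assert (0 < c ^ 2 - 7396 / 10000) by nra.
    assert (0 < t ^ 2 - 7396 / 10000) by nra.
    assert (0 < (c ^ 2 - 7396 / 10000) * (c - 86/100)) by nra.
    assert (0 < (t ^ 2 - 7396 / 10000) * (t - 86/100)) by nra.
    assert (0 < (c ^ 2 - 7396 / 10000) * (t - 86/100)) by nra.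
    assert (0 < (t ^ 2 - 7396 / 10000) * (c - 86/100)) by nra.
    nra. }
  assert (Hlo : 9135454576425 / 10 ^ 13 < c).
  { specialize (Hmono (9135454576425 / 10 ^ 13) ltac:(lra)).
    apply Rnot_le_lt; intro Hle.
    match type of Hmono with 0 < ?g => set (G := g) in * end.
    assert ((c - 9135454576425 / 10 ^ 13) * G =
      (16 * c ^ 4 - 8 * c ^ 3 - 16 * c ^ 2 + 8 * c + 1) -
      (16 * (9135454576425 / 10 ^ 13) ^ 4 - 8 * (9135454576425 / 10 ^ 13) ^ 3
       - 16 * (9135454576425 / 10 ^ 13) ^ 2 + 8 * (9135454576425 / 10 ^ 13) + 1))
      by (unfold G; ring).
    assert ((c - 9135454576425 / 10 ^ 13) * G <= 0) by nra.
    lra. }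
  assert (Hhi : c < 9135454576427 / 10 ^ 13).
  { specialize (Hmono (9135454576427 / 10 ^ 13) ltac:(lra)).
    apply Rnot_le_lt; intro Hle.
    match type of Hmono with 0 < ?g => set (G := g) in * end.
    assert ((c - 9135454576427 / 10 ^ 13) * G =
      (16 * c ^ 4 - 8 * c ^ 3 - 16 * c ^ 2 + 8 * c + 1) -
      (16 * (9135454576427 / 10 ^ 13) ^ 4 - 8 * (9135454576427 / 10 ^ 13) ^ 3
       - 16 * (9135454576427 / 10 ^ 13) ^ 2 + 8 * (9135454576427 / 10 ^ 13) + 1))
      by (unfold G; ring).
    assert (0 <= (c - 9135454576427 / 10 ^ 13) * G) by nra.
    lra. }
  split; apply Rabs_le; [lra|].
  split.
  - assert (4067366430755 / 10 ^ 13 < s); [|lra].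
    apply Rnot_le_lt; intro. nra.
  - assert (s < 4067366430765 / 10 ^ 13); [|lra].
    apply Rnot_le_lt; intro. nra.
Qed.

Definition trig_close (k : nat) (e : R) : Prop :=
  Rabs (cos (2 * PI * INR k / 15) - IZR (fst (nth k trigZ (0, 0)%Z)) / 10 ^ 12) <= e /\
  Rabs (sin (2 * PI * INR k / 15) - IZR (snd (nth k trigZ (0, 0)%Z)) / 10 ^ 12) <= e.

(** One more rotation by 24 degrees. The addition formulas multiply the error by at most
    [0.914 + 0.407 = 1.321], and the inexact table entries and step values add at most
    [4 / 10 ^ 12]. The hypothesis [3 / 10 ^ 11 <= e] lets the factor [3 / 2] absorb both. *)
Lemma trig_close_succ (k : nat) (e : R) :
  3 / 10 ^ 11 <= e ->
  let '(C, s) := nth k trigZ (0, 0)%Z in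
  let '(C', s') := nth (S k) trigZ (0, 0)%Z in
  Rabs (IZR C / 10 ^ 12) <= 1 -> Rabs (IZR s / 10 ^ 12) <= 1 ->
  Rabs (IZR C / 10 ^ 12 * (913545457643 / 10 ^ 12) - IZR s / 10 ^ 12 * (406736643076 / 10 ^ 12)
        - IZR C' / 10 ^ 12) <= 2 / 10 ^ 12 ->
  Rabs (IZR s / 10 ^ 12 * (913545457643 / 10 ^ 12) + IZR C / 10 ^ 12 * (406736643076 / 10 ^ 12)
        - IZR s' / 10 ^ 12) <= 2 / 10 ^ 12 ->
  trig_close k e -> trig_close (S k) (3 / 2 * e).
Proof.
  intros He. unfold trig_close.
  destruct (nth k trigZ _) as [C s], (nth (S k) trigZ _) as [C' s'].
  cbn [fst snd]. intros HC HS H1 H2 [Hc Hs].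
  destruct cos_24_bounds as [Hc1 Hs1].
  replace (2 * PI * INR (S k) / 15) with (2 * PI * INR k / 15 + 2 * PI / 15)
    by (rewrite S_INR; field).
  rewrite cos_plus, sin_plus.
  assert (Bc : Rabs (cos (2 * PI / 15)) <= 914 / 1000).
  { apply Rabs_le; apply Rabs_le_between in Hc1; lra. }
  assert (Bs : Rabs (sin (2 * PI / 15)) <= 407 / 1000).
  { apply Rabs_le; apply Rabs_le_between in Hs1; lra. }
  pose proof (approx_mul _ _ _ _ _ _ _ _ Hc Hc1 HC Bc) as A1.
  pose proof (approx_mul _ _ _ _ _ _ _ _ Hs Hs1 HS Bs) as A2.
  pose proof (approx_mul _ _ _ _ _ _ _ _ Hs Hc1 HS Bc) as A3.
  pose proof (approx_mul _ _ _ _ _ _ _ _ Hc Hs1 HC Bs) as A4.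
  apply Rabs_le_between in H1, H2, A1, A2, A3, A4.
  split; apply Rabs_le; lra.
Qed.

Lemma trig_close_all (k : nat) : (k < 15)%nat -> trig_close k (/ 10 ^ 8).
Proof.
  assert (H0 : trig_close 0 (3 / 10 ^ 11)).
  { unfold trig_close. cbn [nth trigZ fst snd INR].
    replace (2 * PI * 0 / 15) with 0 by field.
    rewrite cos_0, sin_0. split; apply Rabs_le; lra. }
  assert (Hmon : forall k e e', e <= e' -> trig_close k e -> trig_close k e').
  { intros j e e' Hle [? ?]; split; lra. }
  assert (Hall : forall k, (k < 15)%nat -> trig_close k (3 * (3 / 2) ^ k / 10 ^ 11)).
  { clear k. induction k as [|k IH]; intro Hk.
    - revert H0; apply Hmon; lra.
    - specialize (IH ltac:(lia)).
      replace (3 * (3 / 2) ^ S k / 10 ^ 11) with (3 / 2 * (3 * (3 / 2) ^ k / 10 ^ 11)) by (simpl; field).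
      assert (He : 3 / 10 ^ 11 <= 3 * (3 / 2) ^ k / 10 ^ 11).
      { assert (1 <= (3 / 2) ^ k) by (apply pow_R1_Rle; lra). lra. }
      pose proof (trig_close_succ k (3 * (3 / 2) ^ k / 10 ^ 11) He) as Hs.
      revert Hs IH.
      do 14 (destruct k as [|k];
        [cbn [nth trigZ]; intros Hs IH; apply Hs; [apply Rabs_le; lra..| exact IH]|]).
      lia. }
  (* After 14 steps the bound is [3 * (3 / 2) ^ 14 / 10 ^ 11], about [8.8 / 10 ^ 9]. *)
  intro Hk. apply (Hmon _ (3 * (3 / 2) ^ k / 10 ^ 11)); [|auto].
  assert ((3 / 2) ^ k <= (3 / 2) ^ 14) by (apply Rle_pow; [lra|lia]). lra.
Qed.

(** The tolerance is half a unit of the sixth decimal, [5 / 10 ^ 7], with room for the trigonometric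
    errors of [/ 10 ^ 8]. *)
Definition close3 (p : pt3) (v : Z * Z * Z) : Prop :=
  let '(x, y, z) := p in let '(a, b, c) := v in
  Rabs (x - IZR a / 10 ^ 6) <= 6 / 10 ^ 7 /\
  Rabs (y - IZR b / 10 ^ 6) <= 6 / 10 ^ 7 /\
  Rabs (z - IZR c / 10 ^ 6) <= 6 / 10 ^ 7.

Lemma Forall2_close3 : Forall2 close3 Ruperthedron vertsZ.
Proof.
  assert (H := trig_close_all).
  unfold Ruperthedron, C30_orbit.
  change (seq 0 15) with [0;1;2;3;4;5;6;7;8;9;10;11;12;13;14]%nat.
  cbn [flat_map app]. unfold Rz, neg3, D1, D2, D3, vertsZ.
  unfold trig_close in H.
  repeat match goal with
  | |- Forall2 _ (?a :: ?b :: _) _ =>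
    match a with context [INR ?k] =>
      destruct (H k ltac:(lia)) as [Hc Hs]; cbn [nth trigZ fst snd] in Hc, Hs;
      apply Rabs_le_between in Hc, Hs;
      constructor; [|constructor; [|clear Hc Hs]];
      [unfold close3; repeat split; apply Rabs_le; lra..|]
    end
  end.
  constructor.
Qed.

(** * Locally rigid directions of projection *)

Definition dot3 (p q : pt3) : R :=
  let '(x, y, z) := p in let '(x', y', z') := q in x * x' + y * y' + z * z'.

Definition sub3 (p q : pt3) : pt3 :=
  let '(x, y, z) := p in let '(x', y', z') := q in (x - x', y - y', z - z').

Definition dot2 (p q : pt2) : R := fst p * fst q + snd p * snd q.

Definition sub2 (p q : pt2) : pt2 := (fst p - fst q, snd p - snd q).

Definition view (th ph : R) : pt3 := (cos th * sin ph, sin th * sin ph, cos ph).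

Lemma sin_cos_sq (x : R) : sin x * sin x + cos x * cos x = 1.
Proof. exact (sin2_cos2 x). Qed.

Lemma Mproj_sub (th ph : R) (p q : pt3) :
  Mproj th ph (sub3 p q) = sub2 (Mproj th ph p) (Mproj th ph q).
Proof.
  destruct p as [[x y] z], q as [[x' y'] z']; unfold Mproj, sub3, sub2; cbn; f_equal; ring.
Qed.

(** The two rows of [Mproj] and [view] form an orthonormal basis, so this is Parseval's identity
    with one term moved across. *)
Lemma Mproj_dot (th ph : R) (p q : pt3) :
  dot2 (Mproj th ph p) (Mproj th ph q) = dot3 p q - dot3 (view th ph) p * dot3 (view th ph) q.
Proof.
  destruct p as [[x y] z], q as [[x' y'] z']; unfold dot2, Mproj, dot3, view; cbn.
  pose proof (sin_cos_sq th) as Ht. pose proof (sin_cos_sq ph) as Hp.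
  apply Rminus_diag_uniq.
  match goal with |- ?l = 0 => replace l with
    ((sin th * sin th + cos th * cos th - 1) * (x * x' + y * y') +
     (sin ph * sin ph + cos ph * cos ph - 1) *
       (cos th * cos th * x * x' + sin th * sin th * y * y'
        + cos th * sin th * (x * y' + y * x') + z * z')) by ring end.
  rewrite Ht, Hp; ring.
Qed.

Lemma view_norm (th ph : R) : dot3 (view th ph) (view th ph) = 1.
Proof.
  unfold dot3, view.
  pose proof (sin_cos_sq th) as Ht. pose proof (sin_cos_sq ph) as Hp.
  replace (cos th * sin ph * (cos th * sin ph) + sin th * sin ph * (sin th * sin ph) + cos ph * cos ph)
    with ((sin th * sin th + cos th * cos th) * (sin ph * sin ph) + cos ph * cos ph) by ring.
  rewrite Ht; lra.
Qed.

Lemma Cauchy3 (p q : pt3) : dot3 p q ^ 2 <= dot3 p p * dot3 q q.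
Proof.
  destruct p as [[x y] z], q as [[x' y'] z']; unfold dot3.
  assert (0 <= (x * y' - y * x') ^ 2 + (x * z' - z * x') ^ 2 + (y * z' - z * y') ^ 2)
    by (repeat apply Rplus_le_le_0_compat; apply pow2_ge_0).
  lra.
Qed.

Lemma sub3_dot_r (p q r : pt3) : dot3 p (sub3 q r) = dot3 p q - dot3 p r.
Proof. destruct p as [[? ?] ?], q as [[? ?] ?], r as [[? ?] ?]; unfold dot3, sub3; ring. Qed.

Lemma sub3_dot_l (p q r : pt3) : dot3 (sub3 q r) p = dot3 q p - dot3 r p.
Proof. destruct p as [[? ?] ?], q as [[? ?] ?], r as [[? ?] ?]; unfold dot3, sub3; ring. Qed.

Lemma dot3_comm (p q : pt3) : dot3 p q = dot3 q p.
Proof. destruct p as [[? ?] ?], q as [[? ?] ?]; unfold dot3; ring. Qed.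

Lemma dot3_nonneg (p : pt3) : 0 <= dot3 p p.
Proof. destruct p as [[? ?] ?]; unfold dot3; nra. Qed.

Lemma in_conv_linear (Q : list pt2) (x : pt2) (a b c : R) :
  (forall q, In q Q -> a * fst q + b * snd q <= c) ->
  in_conv Q x -> a * fst x + b * snd x <= c.
Proof.
  intros HQ (w & Hlen & Hpos & Hsum & <-).
  assert (H : a * fst (wsum w Q) + b * snd (wsum w Q) <= c * fold_right Rplus 0 w).
  2: rewrite Hsum in H; lra.
  clear Hsum. revert Q HQ Hlen.
  induction Hpos as [|t w Ht Hw IH]; intros [|[u v] Q] HQ Hlen; try discriminate; cbn.
  - lra.
  - specialize (IH Q (fun q Hq => HQ q (or_intror Hq)) ltac:(now injection Hlen)).
    pose proof (HQ _ (or_introl eq_refl)) as H0; cbn in H0.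
    destruct (wsum w Q) as [su sv]; cbn in *.
    assert (t * (a * u + b * v) <= t * c) by (apply Rmult_le_compat_l; auto).
    lra.
Qed.

Lemma in_int_conv_linear (Q : list pt2) (x : pt2) (a b c : R) :
  (forall q, In q Q -> a * fst q + b * snd q <= c) ->
  0 < a ^ 2 + b ^ 2 -> in_int_conv Q x -> a * fst x + b * snd x < c.
Proof.
  intros HQ Hab (e & He & Hx).
  (* From [x], a step [t * (a, b)] along the gradient stays in the ball of radius [e], because a
     length is smaller than one plus its square; it increases the linear form strictly. *)
  set (t := e / (1 + (a ^ 2 + b ^ 2))).
  assert (Ht : t * (1 + (a ^ 2 + b ^ 2)) = e) by (unfold t; field; lra).
  assert (0 < t) by (unfold t; apply Rdiv_lt_0_compat; lra).
  specialize (Hx (fst x + t * a, snd x + t * b)); cbn [fst snd] in Hx.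
  assert (Hy : in_conv Q (fst x + t * a, snd x + t * b)).
  { apply Hx. set (r := a ^ 2 + b ^ 2) in *. rewrite <- Ht.
    replace ((fst x + t * a - fst x) ^ 2 + (snd x + t * b - snd x) ^ 2)
      with (t ^ 2 * r) by (unfold r; ring).
    replace ((t * (1 + r)) ^ 2) with (t ^ 2 * (1 + r) ^ 2) by ring.
    apply Rmult_lt_compat_l; nra. }
  apply (in_conv_linear _ _ a b c HQ) in Hy; cbn [fst snd] in Hy.
  assert (0 < t * (a ^ 2 + b ^ 2)) by (apply Rmult_lt_0_compat; auto).
  lra.
Qed.

(* The hypothesis on [Q] says that every [v - q] makes a definite acute angle
   with [v]; it is written with all directions [(a, b)] to be linear in [q]. *)
Lemma local_max_distance (Q : list pt2) (v u : pt2) (k : R) :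
  0 < k -> k ^ 2 < dot2 v v ->
  (forall q, In q Q -> forall a b, a ^ 2 + b ^ 2 <= 1 ->
     k * dot2 (a, b) (sub2 v q) <= dot2 v (sub2 v q)) ->
  dot2 (sub2 v u) (sub2 v u) <= (2 * k) ^ 2 ->
  in_int_conv Q u -> dot2 u u < dot2 v v.
Proof.
  intros Hk Hv HQ Hd Hu.
  destruct v as [v1 v2], u as [u1 u2]; unfold dot2, sub2 in *; cbn [fst snd] in *.
  (* By [HQ] the linear form with gradient [v - k * (a, b)] attains its maximum over [Q] at [v]; if
     it is nonzero, it is strictly smaller at the interior point [u]. *)
  assert (Hlin : forall a b, a ^ 2 + b ^ 2 <= 1 -> 0 < (v1 - k * a) ^ 2 + (v2 - k * b) ^ 2 ->
     k * (a * (v1 - u1) + b * (v2 - u2)) < v1 * (v1 - u1) + v2 * (v2 - u2)).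
  { intros a b Hab Hg.
    assert (H := in_int_conv_linear Q (u1, u2) (v1 - k * a) (v2 - k * b)
      ((v1 - k * a) * v1 + (v2 - k * b) * v2)).
    cbn [fst snd] in H.
    enough ((v1 - k * a) * u1 + (v2 - k * b) * u2 < (v1 - k * a) * v1 + (v2 - k * b) * v2) by lra.
    apply H; auto.
    intros q Hq. specialize (HQ q Hq a b Hab). lra. }
  set (r2 := (v1 - u1) * (v1 - u1) + (v2 - u2) * (v2 - u2)) in *.
  destruct (Req_dec r2 0) as [H0 | H0].
  - destruct (Rplus_sqr_eq_0 _ _ H0) as [E1 E2].
    unfold Rsqr in E1, E2.
    assert (HL := Hlin 0 0 ltac:(lra)). rewrite E1, E2, !Rmult_0_r, !Rminus_0_r in HL. lra.
  - assert (Hr2 : 0 < r2) 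
      by (apply Rnot_le_lt; intro; apply H0, Rle_antisym; [auto | apply Rplus_le_le_0_compat; apply Rle_0_sqr]).
    set (r := sqrt r2).
    assert (Hr : 0 < r) by (apply sqrt_lt_R0; auto).
    assert (Hrr : r * r = r2) by (apply sqrt_sqrt; lra).
    assert (Hn : ((v1 - u1) / r) ^ 2 + ((v2 - u2) / r) ^ 2 = 1).
    { replace (((v1 - u1) / r) ^ 2 + ((v2 - u2) / r) ^ 2) with (r2 / (r * r))
        by (unfold r2; field; lra).
      rewrite Hrr; field; lra. }
    assert (Hg : 0 < (v1 - k * ((v1 - u1) / r)) ^ 2 + (v2 - k * ((v2 - u2) / r)) ^ 2).
    { set (a := (v1 - u1) / r) in *. set (b := (v2 - u2) / r) in *.
      apply Rnot_le_lt; intro Hle.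
      destruct (Rplus_sqr_eq_0 (v1 - k * a) (v2 - k * b)) as [E1 E2]; 
        [apply Rle_antisym; [unfold Rsqr; lra | apply Rplus_le_le_0_compat; apply Rle_0_sqr]|].
      assert (F1 : v1 = k * a) by lra. assert (F2 : v2 = k * b) by lra.
      assert (Hv' : k ^ 2 < (k * a) * (k * a) + (k * b) * (k * b)) by (rewrite <- F1, <- F2; exact Hv).
      clear Hv; rename Hv' into Hv.
      replace (k * a * (k * a) + k * b * (k * b)) with (k ^ 2 * (a ^ 2 + b ^ 2)) in Hv by ring.
      rewrite Hn in Hv; lra. }
    (* For the unit vector along [v - u] this gives [<v, v - u> > k * r]. As [r <= 2 * k], the
       expansion [|u|^2 = |v|^2 - 2 <v, v - u> + r^2] is then less than [|v|^2]. *)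
    specialize (Hlin _ _ (Req_le _ _ Hn) Hg).
    replace (k * ((v1 - u1) / r * (v1 - u1) + (v2 - u2) / r * (v2 - u2))) with (k * r) in Hlin.
    2:{ replace ((v1 - u1) / r * (v1 - u1) + (v2 - u2) / r * (v2 - u2)) with (r2 / r)
          by (unfold r2; field; lra).
        rewrite <- Hrr; field; lra. }
    assert (r <= 2 * k) by (apply Rsqr_incr_0_var; [unfold Rsqr; lra | lra]).
    assert (r2 <= 2 * k * r) by (rewrite <- Hrr; apply Rmult_le_compat_r; lra).
    unfold r2 in *; lra.
Qed.

(** * How far directions and projections move with the angles *)

Lemma chord_le_arc (a e : R) : Rabs a <= e -> 2 - 2 * cos a <= e ^ 2.
Proof.
  intro H.
  assert (Hs : forall x, sin x ^ 2 <= x ^ 2).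
  { assert (Hpos : forall x, 0 <= x -> sin x ^ 2 <= x ^ 2).
    { intros x Hx. destruct (Rle_or_lt x 1) as [H1|H1].
      - destruct (Req_dec x 0) as [->|]; [rewrite sin_0; lra|].
        assert (sin x < x) by (apply sin_lt_x; lra).
        assert (0 <= sin x) by (apply sin_ge_0; pose proof PI_RGT_0; pose proof PI2_1; lra).
        nra.
      - pose proof (SIN_bound x). nra. }
    intro x. destruct (Rle_or_lt 0 x); [auto|].
    replace (sin x ^ 2) with (sin (- x) ^ 2) by (rewrite sin_neg; ring).
    replace (x ^ 2) with ((- x) ^ 2) by ring. apply Hpos; lra. }
  (* The squared chord is [4 * sin (a / 2) ^ 2]. *)
  replace a with (2 * (a / 2)) by field. rewrite cos_2a_sin.
  specialize (Hs (a / 2)).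
  assert (a ^ 2 <= e ^ 2) by (rewrite <- (pow2_abs a); apply pow_incr; split; [apply Rabs_pos|auto]).
  nra.
Qed.

(** The squared distance equals [(2 - 2 cos (ph1 - ph2)) + 2 sin ph1 sin ph2 (1 - cos (th1 - th2))],
    and each summand is at most [e ^ 2], whatever the signs of the sines. *)
Lemma view_dot_close (th1 ph1 th2 ph2 e : R) :
  Rabs (th1 - th2) <= e -> Rabs (ph1 - ph2) <= e ->
  dot3 (sub3 (view th1 ph1) (view th2 ph2)) (sub3 (view th1 ph1) (view th2 ph2)) <= 2 * e ^ 2.
Proof.
  intros Ht Hp. apply chord_le_arc in Ht, Hp.
  rewrite sub3_dot_r, !sub3_dot_l, !view_norm, (dot3_comm (view th2 ph2)).
  rewrite cos_minus in Ht, Hp. unfold dot3, view.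
  pose proof (COS_bound (th1 - th2)) as Hb. rewrite cos_minus in Hb.
  set (C := cos th1 * cos th2 + sin th1 * sin th2) in *.
  pose proof (SIN_bound ph1). pose proof (SIN_bound ph2).
  assert (sin ph1 * sin ph2 <= 1) by nra.
  assert (sin ph1 * sin ph2 * (1 - C) <= 1 - C) by nra.
  replace (cos th1 * sin ph1 * (cos th2 * sin ph2) + sin th1 * sin ph1 * (sin th2 * sin ph2))
    with (sin ph1 * sin ph2 * C) by (unfold C; ring).
  lra.
Qed.

(** The first row of the matrix changes by at most [e], the second by at most [sqrt 2 * e];
    Cauchy-Schwarz on each row gives the factor 3. *)
Lemma Mproj_close (th1 ph1 th2 ph2 e : R) (p : pt3) :
  Rabs (th1 - th2) <= e -> Rabs (ph1 - ph2) <= e -> dot3 p p <= 1 ->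
  dot2 (sub2 (Mproj th1 ph1 p) (Mproj th2 ph2 p)) (sub2 (Mproj th1 ph1 p) (Mproj th2 ph2 p))
    <= 3 * e ^ 2.
Proof.
  intros Ht Hp Hn. apply chord_le_arc in Ht, Hp.
  set (r1 := (sin th2 - sin th1, cos th1 - cos th2, 0) : pt3).
  set (r2 := (cos th2 * cos ph2 - cos th1 * cos ph1, sin th2 * cos ph2 - sin th1 * cos ph1,
              sin ph1 - sin ph2) : pt3).
  assert (E : dot2 (sub2 (Mproj th1 ph1 p) (Mproj th2 ph2 p)) (sub2 (Mproj th1 ph1 p) (Mproj th2 ph2 p))
    = dot3 r1 p ^ 2 + dot3 r2 p ^ 2).
  { destruct p as [[x y] z]. unfold dot2, sub2, Mproj, r1, r2, dot3; cbn [fst snd]; ring. }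
  rewrite E; clear E.
  pose proof (sin_cos_sq th1) as T1. pose proof (sin_cos_sq th2) as T2.
  pose proof (sin_cos_sq ph1) as F1. pose proof (sin_cos_sq ph2) as F2.
  rewrite cos_minus in Ht, Hp.
  assert (H1 : dot3 r1 r1 <= e ^ 2) by (unfold r1, dot3; nra).
  assert (H2 : dot3 r2 r2 <= 2 * e ^ 2).
  { pose proof (COS_bound (th1 - th2)) as Hb. rewrite cos_minus in Hb.
    set (C := cos th1 * cos th2 + sin th1 * sin th2) in *.
    pose proof (COS_bound ph1). pose proof (COS_bound ph2).
    assert (cos ph1 * cos ph2 <= 1) by nra.
    assert (cos ph1 * cos ph2 * (1 - C) <= 1 - C) by nra.
    replace (dot3 r2 r2) with
      ((sin th2 * sin th2 + cos th2 * cos th2) * (cos ph2 * cos ph2)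
       + (sin th1 * sin th1 + cos th1 * cos th1) * (cos ph1 * cos ph1)
       - 2 * (cos ph1 * cos ph2 * C) + sin ph1 * sin ph1 + sin ph2 * sin ph2 - 2 * (sin ph1 * sin ph2))
      by (unfold r2, dot3, C; ring).
    rewrite T1, T2. lra. }
  pose proof (Cauchy3 r1 p). pose proof (Cauchy3 r2 p).
  pose proof (dot3_nonneg r1). pose proof (dot3_nonneg r2). pose proof (dot3_nonneg p).
  nra.
Qed.

Lemma Rot_close (a e : R) (m : pt2) :
  Rabs a <= e -> dot2 m m <= 1 -> dot2 (sub2 (Rot a m) m) (sub2 (Rot a m) m) <= e ^ 2.
Proof.
  intros Ha Hm. apply chord_le_arc in Ha.
  destruct m as [u v]. unfold dot2, sub2, Rot in *; cbn [fst snd] in *.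
  pose proof (sin_cos_sq a). pose proof (COS_bound a).
  replace ((cos a * u - sin a * v - u) * (cos a * u - sin a * v - u) +
     (sin a * u + cos a * v - v) * (sin a * u + cos a * v - v))
    with ((sin a * sin a + cos a * cos a + 1 - 2 * cos a) * (u * u + v * v)) by ring.
  rewrite H. assert (0 <= u * u + v * v) by nra. nra.
Qed.

Lemma Rot_norm (a : R) (m : pt2) : dot2 (Rot a m) (Rot a m) = dot2 m m.
Proof.
  destruct m as [u v]. unfold dot2, Rot; cbn [fst snd].
  replace ((cos a * u - sin a * v) * (cos a * u - sin a * v) +
     (sin a * u + cos a * v) * (sin a * u + cos a * v))
    with ((sin a * sin a + cos a * cos a) * (u * u + v * v)) by ring.
  rewrite sin_cos_sq; ring.
Qed.

(** With [w = v - q] the right-hand side is [<M v, M w>] for the projection [M] along [X]. The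
    intended condition is [k |M w| <= <M v, M w>] with [k = 41 / 50000]; the quantity
    [4 |w|^2 + / 16], which is at least [|w|], makes it polynomial in the data. *)
Definition anchored (P : list pt3) (X v : pt3) : Prop :=
  In v P /\ 9 / 20000 <= dot3 X v /\
  forall q, In q P -> q = v \/
    41 / 50000 * (4 * dot3 (sub3 v q) (sub3 v q) + / 16)
      <= dot3 v (sub3 v q) - dot3 X v * dot3 X (sub3 v q).

(** The vector identity for [X] is tested by inner products with all [Y], the form that transports
    along isometries and that Cramer's rule yields. *)
Definition rigid_view (P : list pt3) (X : pt3) : Prop :=
  exists v1 v2 v3 m1 m2 m3,
    (anchored P X v1 /\ anchored P X v2 /\ anchored P X v3) /\
    (0 <= m1 /\ 0 <= m2 /\ 0 <= m3) /\
    forall Y, dot3 Y X = m1 * dot3 Y v1 + m2 * dot3 Y v2 + m3 * dot3 Y v3.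

Lemma anchored_drifts (P : list pt3) (th1 ph1 th2 ph2 a : R) (v : pt3) :
  (forall p, In p P -> dot3 p p <= 1) -> (forall p, In p P -> In (neg3 p) P) ->
  anchored P (view th2 ph2) v ->
  Rabs (th1 - th2) <= 6 / 10000 -> Rabs (ph1 - ph2) <= 6 / 10000 -> Rabs a <= 6 / 10000 ->
  rupert_cond P 1 th1 ph1 th2 ph2 a ->
  dot3 (view th2 ph2) v < dot3 (view th1 ph1) v.
Proof.
  intros Hball Hneg (Hin & Hpos & Hanch) Ht Hp Ha HR.
  set (X1 := view th1 ph1) in *. set (X2 := view th2 ph2) in *.
  assert (Hv := Hball v Hin).
  assert (Hlt : dot2 (Rot a (Mproj th1 ph1 v)) (Rot a (Mproj th1 ph1 v))
            < dot2 (Mproj th2 ph2 v) (Mproj th2 ph2 v)).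
  { apply (local_max_distance (map (Mproj th2 ph2) P) _ _ (41 / 50000)).
    - lra.
    (* Anchoring against the antipode, where [v - q = 2 v], bounds [|M2 v|^2] below by [k / 32],
       which exceeds [k ^ 2]. *)
    - destruct (Hanch (neg3 v) (Hneg v Hin)) as [E | H].
      + exfalso. destruct v as [[x y] z]. injection E as E1 E2 E3.
        replace x with 0 in * by lra. replace y with 0 in * by lra. replace z with 0 in * by lra.
        unfold dot3 in Hpos. destruct X2 as [[? ?] ?]. lra.
      + rewrite Mproj_dot. fold X2.
        assert (E : forall Y, dot3 Y (sub3 v (neg3 v)) = 2 * dot3 Y v).
        { intro Y. destruct v as [[x y] z], Y as [[? ?] ?]; unfold dot3, sub3, neg3; ring. }
        pose proof (dot3_nonneg (sub3 v (neg3 v))). rewrite !(E v), (E X2) in H.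
        lra.
    - intros q' Hq' b c Hbc. apply in_map_iff in Hq' as (q & <- & Hq).
      rewrite <- Mproj_sub.
      destruct (Hanch q Hq) as [-> | H].
      + replace (Mproj th2 ph2 (sub3 v v)) with ((0, 0) : pt2).
        * unfold dot2; cbn [fst snd]; lra.
        * destruct v as [[x y] z]; unfold Mproj, sub3; f_equal; ring.
      + rewrite Mproj_dot. fold X2. set (w := sub3 v q) in *.
        refine (Rle_trans _ _ _ _ H). apply Rmult_le_compat_l; [lra|].
        pose proof (Mproj_dot th2 ph2 w w) as Hw.
        fold X2 in Hw. set (m := Mproj th2 ph2 w) in *. destruct m as [m1 m2].
        unfold dot2 in *; cbn [fst snd] in *.
        assert (Hc : (b * m1 + c * m2) ^ 2 <= m1 * m1 + m2 * m2).
        { assert (0 <= (b * m2 - c * m1) ^ 2) by apply pow2_ge_0. nra. }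
        (* This square says that [t <= 4 * t ^ 2 + / 16] for [t = b * m1 + c * m2], and
           [t ^ 2 <= |M2 w|^2 <= |w|^2]. *)
        pose proof (pow2_ge_0 (2 * (b * m1 + c * m2) - / 4)). pose proof (Rle_0_sqr (dot3 X2 w)) as Hs.
        unfold Rsqr in Hs. lra.
    - set (n1 := Mproj th1 ph1 v). set (n2 := Mproj th2 ph2 v).
      assert (Hn1 : dot2 n1 n1 <= 1).
      { unfold n1. rewrite Mproj_dot. fold X1. nra. }
      pose proof (Rot_close a _ n1 Ha Hn1) as E1.
      pose proof (Mproj_close th1 ph1 th2 ph2 _ v Ht Hp Hv) as E2.
      fold n1 n2 in E2. set (u := Rot a n1) in *.
      destruct u as [u1 u2], n1 as [a1 a2], n2 as [b1 b2].
      unfold dot2, sub2 in *; cbn [fst snd] in *.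
      (* [|x + y|^2 <= (1 + t) |x|^2 + (1 + 1 / t) |y|^2] with [t = 7 / 4]. *)
      assert (0 <= (7 / 4 * (u1 - a1) - (a1 - b1)) ^ 2) by apply pow2_ge_0.
      assert (0 <= (7 / 4 * (u2 - a2) - (a2 - b2)) ^ 2) by apply pow2_ge_0.
      nra.
    - specialize (HR v Hin). unfold scale2 in HR.
      destruct (Rot a (Mproj th1 ph1 v)) as [u1 u2]. rewrite !Rmult_1_l in HR. exact HR. }
  rewrite Rot_norm, !Mproj_dot in Hlt. fold X1 X2 in Hlt.
  pose proof (view_dot_close th1 ph1 th2 ph2 _ Ht Hp) as HX. fold X1 X2 in HX.
  pose proof (Cauchy3 (sub3 X1 X2) v) as HC. rewrite sub3_dot_l in HC.
  pose proof (dot3_nonneg (sub3 X1 X2)).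
  assert ((dot3 X1 v - dot3 X2 v) ^ 2 <= 2 * (6 / 10000) ^ 2) by nra.
  set (x := dot3 X1 v) in *. set (y := dot3 X2 v) in *. clearbody x y.
  (* Now [y ^ 2 < x ^ 2]. If [x <= y], then [x < - y], so [y - x] exceeds [2 * y >= 9 / 10000],
     which is more than the possible drift [sqrt 2 * 6 / 10000]. *)
  apply Rnot_le_lt; intro Hle.
  assert (x + y < 0) by nra.
  assert (9 / 10000 <= y - x) by lra. nra.
Qed.

Lemma rigid_view_no_rupert (P : list pt3) (th1 ph1 th2 ph2 a : R) :
  (forall p, In p P -> dot3 p p <= 1) -> (forall p, In p P -> In (neg3 p) P) ->
  rigid_view P (view th2 ph2) ->
  Rabs (th1 - th2) <= 6 / 10000 -> Rabs (ph1 - ph2) <= 6 / 10000 -> Rabs a <= 6 / 10000 ->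
  ~ rupert_cond P 1 th1 ph1 th2 ph2 a.
Proof.
  intros Hball Hneg (v1 & v2 & v3 & m1 & m2 & m3 & (A1 & A2 & A3) & (M1 & M2 & M3) & HX) Ht Hp Ha HR.
  pose proof (anchored_drifts P th1 ph1 th2 ph2 a v1 Hball Hneg A1 Ht Hp Ha HR) as L1.
  pose proof (anchored_drifts P th1 ph1 th2 ph2 a v2 Hball Hneg A2 Ht Hp Ha HR) as L2.
  pose proof (anchored_drifts P th1 ph1 th2 ph2 a v3 Hball Hneg A3 Ht Hp Ha HR) as L3.
  set (X1 := view th1 ph1) in *. set (X2 := view th2 ph2) in *.
  assert (H1 : dot3 X2 X2 = 1) by apply view_norm.
  assert (HC : dot3 X1 X2 ^ 2 <= 1).
  { pose proof (Cauchy3 X1 X2) as HC. unfold X1, X2 in HC. rewrite !view_norm in HC. fold X1 X2 in HC. lra. }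
  rewrite (HX X2) in H1. rewrite (HX X1) in HC.
  set (a1 := dot3 X2 v1) in *. set (a2 := dot3 X2 v2) in *. set (a3 := dot3 X2 v3) in *.
  set (b1 := dot3 X1 v1) in *. set (b2 := dot3 X1 v2) in *. set (b3 := dot3 X1 v3) in *.
  (* Strictness needs one positive weight; if all were zero, [X2] would have norm zero. *)
  assert (Hgt : 1 < m1 * b1 + m2 * b2 + m3 * b3).
  { assert (m1 * a1 <= m1 * b1) by nra. assert (m2 * a2 <= m2 * b2) by nra.
    assert (m3 * a3 <= m3 * b3) by nra.
    destruct (Rlt_or_le 0 m1); [assert (m1 * a1 < m1 * b1) by nra; lra|].
    destruct (Rlt_or_le 0 m2); [assert (m2 * a2 < m2 * b2) by nra; lra|].
    destruct (Rlt_or_le 0 m3); [assert (m3 * a3 < m3 * b3) by nra; lra|].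
    replace m1 with 0 in * by lra. replace m2 with 0 in * by lra. replace m3 with 0 in * by lra. lra. }
  nra.
Qed.

(** Anchoring is expressed by inner products only. The explicit inverse [g'] pulls a competing
    vertex [q] back into [P]. *)
Lemma rigid_view_isometry (P : list pt3) (g g' : pt3 -> pt3) (X : pt3) :
  (forall p q, dot3 (g p) (g q) = dot3 p q) ->
  (forall p q, sub3 (g p) (g q) = g (sub3 p q)) ->
  (forall p, g (g' p) = p) ->
  (forall p, In p P -> In (g p) P) -> (forall p, In p P -> In (g' p) P) ->
  rigid_view P X -> rigid_view P (g X).
Proof.
  intros Hdot Hsub Hinv HP HP' (v1 & v2 & v3 & m1 & m2 & m3 & (A1 & A2 & A3) & M & HX).
  assert (HA : forall v, anchored P X v -> anchored P (g X) (g v)).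
  { intros v (Hin & Hpos & Hq). split; [auto|]. rewrite Hdot. split; [auto|].
    intros q Hqin. destruct (Hq (g' q) (HP' q Hqin)) as [<- | H].
    - left. now rewrite Hinv.
    - right. rewrite <- (Hinv q), Hsub, !Hdot. exact H. }
  exists (g v1), (g v2), (g v3), m1, m2, m3.
  split; [auto | split; [exact M |]].
  intro Y. rewrite <- (Hinv Y), !Hdot. apply HX.
Qed.

(** * Certificates for spherical triangles *)

Definition dotZ (p q : Z * Z * Z) : Z :=
  let '(x, y, z) := p in let '(x', y', z') := q in (x * x' + y * y' + z * z')%Z.

Definition subZ (p q : Z * Z * Z) : Z * Z * Z :=
  let '(x, y, z) := p in let '(x', y', z') := q in (x - x', y - y', z - z')%Z.

Definition addZ (p q : Z * Z * Z) : Z * Z * Z :=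
  let '(x, y, z) := p in let '(x', y', z') := q in (x + x', y + y', z + z')%Z.

Definition dblZ (p : Z * Z * Z) : Z * Z * Z :=
  let '(x, y, z) := p in (2 * x, 2 * y, 2 * z)%Z.

Definition crossZ (p q : Z * Z * Z) : Z * Z * Z :=
  let '(x, y, z) := p in let '(x', y', z') := q in
  (y * z' - z * y', z * x' - x * z', x * y' - y * x')%Z.

Definition sumZ (p : Z * Z * Z) : Z := let '(x, y, z) := p in (x + y + z)%Z.

Definition vertZ (i : nat) : Z * Z * Z := nth i vertsZ (0, 0, 0)%Z.

(* A lower bound, scaled by [10 ^ 12], for
   [<v, w> - 41 / 50000 * (4 |w|^2 + 1 / 16) - 3 / 10 ^ 5] with [w = v - q];
   the last term pays for the rounding of the vertices. *)
Definition slackZ (v q : Z * Z * Z) : Z :=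
  let w := subZ v q in
  (dotZ v w + (- 41 * (64 * dotZ w w + 10 ^ 12)) / 800000 - 30 * 10 ^ 6)%Z.

(** The diagonal entry 0 always passes [slack_check], since there [v - q] vanishes and so
    [n = 0]. *)
Definition slack_row (i : nat) : list Z :=
  map (fun j => if Nat.eqb i j then 0%Z else slackZ (vertZ i) (vertZ j)) (seq 0 90).

(* A corner of a spherical triangle carries its inner products with all vertices,
   so that bisecting a triangle only costs additions. *)
Definition corner : Type := (Z * Z * Z) * list Z.

Definition mk_corner (p : Z * Z * Z) : corner := (p, map (dotZ p) vertsZ).

Fixpoint add_list (l m : list Z) : list Z :=
  match l, m with
  | x :: l', y :: m' => (x + y)%Z :: add_list l' m'
  | _, _ => []
  end.

Definition add_corner (p q : corner) : corner :=
  (addZ (fst p) (fst q), add_list (snd p) (snd q)).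

Definition dbl_corner (p : corner) : corner :=
  (dblZ (fst p), map (Z.mul 2) (snd p)).

(** Here [m] bounds the inner products of the corners with [v], and [n] those with [v - q]. For a
    unit [X] in the cone, [<X, v> <X, v - q>] is then at most [m * n / g], to be compared with the
    slack [k]; for [n <= 0] the product is not positive. *)
Fixpoint slack_check (g m a b c : Z) (row dA dB dC : list Z) : bool :=
  match row, dA, dB, dC with
  | k :: row', x :: dA', y :: dB', z :: dC' =>
    (0 <=? k)%Z &&
    (let n := Z.max (a - x) (Z.max (b - y) (c - z)) in
     if (n <=? 0)%Z then true else (m * n <=? k * g)%Z) &&
    slack_check g m a b c row' dA' dB' dC'
  | _, _, _, _ => true
  end.

(** The three sum tests amount to [<X, v> >= 0.0005 * sum3 X], linear in [X] and hence decided at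
    the corners. *)
Definition anchor_check (rows : list (list Z)) (A B C : corner) (g : Z) (i : nat) : bool :=
  let a := nth i (snd A) 0%Z in
  let b := nth i (snd B) 0%Z in
  let c := nth i (snd C) 0%Z in
  (i <? 90)%nat &&
  (10 ^ 6 * sumZ (fst A) <=? 2000 * a)%Z &&
  (10 ^ 6 * sumZ (fst B) <=? 2000 * b)%Z &&
  (10 ^ 6 * sumZ (fst C) <=? 2000 * c)%Z &&
  slack_check g (Z.max 0 (Z.max a (Z.max b c))) a b c (nth i rows []) (snd A) (snd B) (snd C).

(** In true scale: [X] lies on the inner side of the plane through the origin and the two vertices,
    with margin [/ 10 ^ 5 * sum3 X]. *)
Definition side_check (A B C : corner) (i j : nat) : bool :=
  let n := crossZ (vertZ i) (vertZ j) in
  (10 ^ 7 * sumZ (fst A) <=? dotZ (fst A) n)%Z &&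
  (10 ^ 7 * sumZ (fst B) <=? dotZ (fst B) n)%Z &&
  (10 ^ 7 * sumZ (fst C) <=? dotZ (fst C) n)%Z.

Definition min_gram (p q r : Z * Z * Z) : Z :=
  Z.min (dotZ p p) (Z.min (dotZ q q) (Z.min (dotZ r r)
    (Z.min (dotZ p q) (Z.min (dotZ p r) (dotZ q r))))).

Inductive cover : Type :=
| Leaf (i j k : nat)
| Node (l r : cover).

(** Newest-vertex bisection: the side [A B] is cut, and the midpoint becomes the last corner, so
    that the side opposite to it is cut next. Doubling the old corners keeps all coordinates
    integral and all corners on one common scale, which the tests, being homogeneous, tolerate. *)
Fixpoint cover_check (rows : list (list Z)) (t : cover) (A B C : corner) : bool :=
  match t with
  | Leaf i j k =>
    let g := min_gram (fst A) (fst B) (fst C) in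
    side_check A B C i j && side_check A B C j k && side_check A B C k i &&
    (10 ^ 16 <=? dotZ (vertZ i) (crossZ (vertZ j) (vertZ k)))%Z &&
    anchor_check rows A B C g i && anchor_check rows A B C g j && anchor_check rows A B C g k
  | Node l r =>
    let M := add_corner A B in
    let C2 := dbl_corner C in
    cover_check rows l C2 (dbl_corner A) M && cover_check rows r (dbl_corner B) C2 M
  end.

(** * From integer tests at the corners to real inequalities on the cone *)

Definition toR3 (p : Z * Z * Z) : pt3 := let '(x, y, z) := p in (IZR x, IZR y, IZR z).

Definition cross3 (p q : pt3) : pt3 :=
  let '(x, y, z) := p in let '(x', y', z') := q in
  (y * z' - z * y', z * x' - x * z', x * y' - y * x').

Definition sum3 (p : pt3) : R := let '(x, y, z) := p in x + y + z.

Ltac izr := rewrite ?plus_IZR, ?minus_IZR, ?mult_IZR.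

Lemma dot3_toR3 (p q : Z * Z * Z) : dot3 (toR3 p) (toR3 q) = IZR (dotZ p q).
Proof. destruct p as [[? ?] ?], q as [[? ?] ?]; cbn; izr; reflexivity. Qed.

Lemma cross3_toR3 (p q : Z * Z * Z) : cross3 (toR3 p) (toR3 q) = toR3 (crossZ p q).
Proof. destruct p as [[? ?] ?], q as [[? ?] ?]; cbn; izr; reflexivity. Qed.

Lemma add_corner_mk (p q : Z * Z * Z) :
  add_corner (mk_corner p) (mk_corner q) = mk_corner (addZ p q).
Proof.
  unfold add_corner, mk_corner; cbn [fst snd]. f_equal.
  induction vertsZ as [|[[x y] z] V IH]; [reflexivity|].
  cbn [map add_list]. f_equal; [|exact IH].
  destruct p as [[? ?] ?], q as [[? ?] ?]; cbn; ring.
Qed.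

Lemma dbl_corner_mk (p : Z * Z * Z) : dbl_corner (mk_corner p) = mk_corner (dblZ p).
Proof.
  unfold dbl_corner, mk_corner; cbn [fst snd]. f_equal.
  rewrite map_map. apply map_ext. intros [[x y] z]. destruct p as [[? ?] ?].
  unfold dotZ, dblZ; ring.
Qed.

Definition cone_comb (a b c : R) (p q r : Z * Z * Z) (X : pt3) : Prop :=
  forall Y, dot3 X Y = a * dot3 (toR3 p) Y + b * dot3 (toR3 q) Y + c * dot3 (toR3 r) Y.

Definition in_cone (p q r : Z * Z * Z) (X : pt3) : Prop :=
  exists a b c, 0 <= a /\ 0 <= b /\ 0 <= c /\ cone_comb a b c p q r X.

(** If [b <= a], then [a p + b q = (a - b) p + b (p + q)]; the halves in the witnesses undo the
    doubling. *)
Lemma in_cone_bisect (p q r : Z * Z * Z) (X : pt3) :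
  in_cone p q r X ->
  in_cone (dblZ r) (dblZ p) (addZ p q) X \/ in_cone (dblZ q) (dblZ r) (addZ p q) X.
Proof.
  intros (a & b & c & Ha & Hb & Hc & HX).
  destruct p as [[p1 p2] p3], q as [[q1 q2] q3], r as [[r1 r2] r3].
  destruct (Rle_or_lt b a); [left; exists (c / 2), ((a - b) / 2), b
                            | right; exists ((b - a) / 2), (c / 2), a];
    (split; [lra | split; [lra | split; [lra|]]]);
    intros [[y1 y2] y3]; rewrite HX; unfold dot3, toR3, dblZ, addZ; izr; field.
Qed.

Lemma cone_comb_sum (a b c : R) (p q r : Z * Z * Z) (X : pt3) :
  cone_comb a b c p q r X -> sum3 X = a * IZR (sumZ p) + b * IZR (sumZ q) + c * IZR (sumZ r).
Proof.
  intro H. specialize (H (1, 1, 1)).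
  destruct p as [[? ?] ?], q as [[? ?] ?], r as [[? ?] ?], X as [[? ?] ?].
  unfold dot3, toR3 in H. unfold sumZ, sum3. izr. lra.
Qed.

Lemma cone_comb_linear (a b c : R) (p q r v : Z * Z * Z) (X : pt3) (s t : Z) :
  0 <= a -> 0 <= b -> 0 <= c -> cone_comb a b c p q r X ->
  (s * sumZ p <= t * dotZ p v)%Z -> (s * sumZ q <= t * dotZ q v)%Z ->
  (s * sumZ r <= t * dotZ r v)%Z ->
  IZR s * sum3 X <= IZR t * dot3 X (toR3 v).
Proof.
  intros Ha Hb Hc HX Hp Hq Hr.
  rewrite (cone_comb_sum _ _ _ _ _ _ _ HX), HX, !dot3_toR3.
  apply IZR_le in Hp, Hq, Hr. rewrite !mult_IZR in Hp, Hq, Hr.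
  nra.
Qed.

Lemma slack_check_sound (g m a b c : Z) (row dA dB dC : list Z) :
  slack_check g m a b c row dA dB dC = true ->
  forall j, (j < length row)%nat -> (j < length dA)%nat -> (j < length dB)%nat ->
  (j < length dC)%nat ->
  let k := nth j row 0%Z in
  let n := Z.max (a - nth j dA 0%Z) (Z.max (b - nth j dB 0%Z) (c - nth j dC 0%Z)) in
  (0 <= k)%Z /\ ((n <= 0)%Z \/ (m * n <= k * g)%Z).
Proof.
  revert dA dB dC. induction row as [|k row IH]; intros [|x dA] [|y dB] [|z dC] H j;
    cbn [length]; try lia.
  cbn [slack_check] in H. apply andb_prop in H as [H Hrec]. apply andb_prop in H as [H1 H2].
  apply Z.leb_le in H1. intros Lr La Lb Lc. destruct j as [|j].
  - cbn [nth]. split; [exact H1|].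
    destruct (Z.leb_spec (Z.max (a - x) (Z.max (b - y) (c - z))) 0); [now left | right].
    apply Z.leb_le; exact H2.
  - apply (IH dA dB dC Hrec j); lia.
Qed.

(** [|X|^2 = 1] is a quadratic form in the nonnegative weights whose coefficients are Gram entries;
    replacing each by the least one leaves a multiple of [(a + b + c) ^ 2]. This bounds the weights
    without computing a norm. *)
Lemma min_gram_cone (a b c : R) (p q r : Z * Z * Z) (X : pt3) :
  0 <= a -> 0 <= b -> 0 <= c -> cone_comb a b c p q r X -> dot3 X X = 1 ->
  IZR (min_gram p q r) * (a + b + c) ^ 2 <= 1.
Proof.
  intros Ha Hb Hc HX H1.
  rewrite HX, !(dot3_comm _ X), !HX, !dot3_toR3 in H1.
  assert (G1 : (min_gram p q r <= dotZ p p)%Z) by (unfold min_gram; lia).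
  assert (G2 : (min_gram p q r <= dotZ q q)%Z) by (unfold min_gram; lia).
  assert (G3 : (min_gram p q r <= dotZ r r)%Z) by (unfold min_gram; lia).
  assert (G4 : (min_gram p q r <= dotZ p q)%Z) by (unfold min_gram; lia).
  assert (G5 : (min_gram p q r <= dotZ p r)%Z) by (unfold min_gram; lia).
  assert (G6 : (min_gram p q r <= dotZ q r)%Z) by (unfold min_gram; lia).
  apply IZR_le in G1, G2, G3, G4, G5, G6.
  assert (Hs : forall u v, dotZ u v = dotZ v u).
  { intros [[? ?] ?] [[? ?] ?]; unfold dotZ; ring. }
  rewrite (Hs q p), (Hs r p), (Hs r q) in H1.
  set (g := IZR (min_gram p q r)) in *.
  assert (a * a * g <= a * a * IZR (dotZ p p)) by (apply Rmult_le_compat_l; [nra|auto]).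
  assert (b * b * g <= b * b * IZR (dotZ q q)) by (apply Rmult_le_compat_l; [nra|auto]).
  assert (c * c * g <= c * c * IZR (dotZ r r)) by (apply Rmult_le_compat_l; [nra|auto]).
  assert (a * b * g <= a * b * IZR (dotZ p q)) by (apply Rmult_le_compat_l; [nra|auto]).
  assert (a * c * g <= a * c * IZR (dotZ p r)) by (apply Rmult_le_compat_l; [nra|auto]).
  assert (b * c * g <= b * c * IZR (dotZ q r)) by (apply Rmult_le_compat_l; [nra|auto]).
  lra.
Qed.

(* With [s = a + b + c]: [<X, v> <= m s], [<X, w> <= n s] and [g s ^ 2 <= 1], where [g] is the
   least entry of the Gram matrix of the corners. *)
Lemma cone_slack (a b c : R) (p q r v w : Z * Z * Z) (X : pt3) (k m n : Z) :
  0 <= a -> 0 <= b -> 0 <= c -> cone_comb a b c p q r X -> dot3 X X = 1 ->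
  0 <= dot3 X (toR3 v) ->
  (dotZ p v <= m)%Z -> (dotZ q v <= m)%Z -> (dotZ r v <= m)%Z -> (0 <= m)%Z ->
  (dotZ p w <= n)%Z -> (dotZ q w <= n)%Z -> (dotZ r w <= n)%Z ->
  (0 <= k)%Z -> (n <= 0)%Z \/ (m * n <= k * min_gram p q r)%Z ->
  dot3 X (toR3 v) * dot3 X (toR3 w) <= IZR k.
Proof.
  intros Ha Hb Hc HX H1 Hv Vp Vq Vr Hm Wp Wq Wr Hk Hn.
  pose proof (min_gram_cone _ _ _ _ _ _ _ Ha Hb Hc HX H1) as HG.
  apply IZR_le in Vp, Vq, Vr, Hm, Wp, Wq, Wr, Hk.
  assert (EV : dot3 X (toR3 v) <= IZR m * (a + b + c)) by (rewrite HX, !dot3_toR3; nra).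
  assert (EW : dot3 X (toR3 w) <= IZR n * (a + b + c)) by (rewrite HX, !dot3_toR3; nra).
  set (x := dot3 X (toR3 v)) in *. set (y := dot3 X (toR3 w)) in *.
  clearbody x y. set (s := a + b + c) in *. assert (Hs : 0 <= s) by (unfold s; lra). clearbody s.
  destruct (Rle_or_lt y 0) as [Hy | Hy]; [nra|].
  destruct Hn as [Hn | Hn].
  - apply IZR_le in Hn. nra.
  - apply IZR_le in Hn. rewrite !mult_IZR in Hn.
    apply Rle_trans with (IZR m * s * y); [nra|].
    apply Rle_trans with (IZR m * s * (IZR n * s)); [apply Rmult_le_compat_l; nra|].
    replace (IZR m * s * (IZR n * s)) with (IZR m * IZR n * s ^ 2) by ring.
    apply Rle_trans with (IZR k * IZR (min_gram p q r) * s ^ 2); [apply Rmult_le_compat_r; nra|].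
    nra.
Qed.

(** * Error bounds: from rounded to exact vertices *)

Definition near3 (e : R) (p q : pt3) : Prop :=
  let '(x, y, z) := sub3 p q in Rabs x <= e /\ Rabs y <= e /\ Rabs z <= e.

Definition bounded3 (b : R) (p : pt3) : Prop :=
  let '(x, y, z) := p in Rabs x <= b /\ Rabs y <= b /\ Rabs z <= b.

Lemma near3_dot (e f a b : R) (p p' q q' : pt3) :
  near3 e p p' -> near3 f q q' -> bounded3 a p' -> bounded3 b q ->
  Rabs (dot3 p q - dot3 p' q') <= 3 * (e * b + a * f).
Proof.
  destruct p as [[p1 p2] p3], p' as [[p1' p2'] p3'], q as [[q1 q2] q3], q' as [[q1' q2'] q3'].
  intros (A1 & A2 & A3) (B1 & B2 & B3) (C1 & C2 & C3) (D1 & D2 & D3).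
  pose proof (approx_mul _ _ _ _ _ _ _ _ A1 B1 C1 D1) as H1.
  pose proof (approx_mul _ _ _ _ _ _ _ _ A2 B2 C2 D2) as H2.
  pose proof (approx_mul _ _ _ _ _ _ _ _ A3 B3 C3 D3) as H3.
  apply Rabs_le_between in H1, H2, H3. unfold dot3. apply Rabs_le; lra.
Qed.

Lemma near3_sub (e f : R) (p p' q q' : pt3) :
  near3 e p p' -> near3 f q q' -> near3 (e + f) (sub3 p q) (sub3 p' q').
Proof.
  destruct p as [[p1 p2] p3], p' as [[p1' p2'] p3'], q as [[q1 q2] q3], q' as [[q1' q2'] q3'].
  intros (A1 & A2 & A3) (B1 & B2 & B3).
  apply Rabs_le_between in A1, A2, A3, B1, B2, B3.
  repeat split; apply Rabs_le; lra.
Qed.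

Lemma near3_cross (e a b : R) (p p' q q' : pt3) :
  near3 e p p' -> near3 e q q' -> bounded3 a p' -> bounded3 b q -> bounded3 a q' -> bounded3 b p ->
  near3 (2 * (e * b + a * e)) (cross3 p q) (cross3 p' q').
Proof.
  destruct p as [[p1 p2] p3], p' as [[p1' p2'] p3'], q as [[q1 q2] q3], q' as [[q1' q2'] q3'].
  intros (A1 & A2 & A3) (B1 & B2 & B3) (C1 & C2 & C3) (D1 & D2 & D3) (E1 & E2 & E3) (F1 & F2 & F3).
  pose proof (approx_mul _ _ _ _ _ _ _ _ A2 B3 C2 D3) as H1.
  pose proof (approx_mul _ _ _ _ _ _ _ _ A3 B2 C3 D2) as H2.
  pose proof (approx_mul _ _ _ _ _ _ _ _ A3 B1 C3 D1) as H3.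
  pose proof (approx_mul _ _ _ _ _ _ _ _ A1 B3 C1 D3) as H4.
  pose proof (approx_mul _ _ _ _ _ _ _ _ A1 B2 C1 D2) as H5.
  pose proof (approx_mul _ _ _ _ _ _ _ _ A2 B1 C2 D1) as H6.
  apply Rabs_le_between in H1, H2, H3, H4, H5, H6.
  repeat split; apply Rabs_le; lra.
Qed.

Lemma near3_refl (p : pt3) : near3 0 p p.
Proof.
  destruct p as [[x y] z]; unfold near3, sub3.
  repeat split; apply Rabs_le; lra.
Qed.

Lemma near3_bounded (e b : R) (p q : pt3) : near3 e p q -> bounded3 b p -> bounded3 (b + e) q.
Proof.
  destruct p as [[p1 p2] p3], q as [[q1 q2] q3].
  intros (A1 & A2 & A3) (B1 & B2 & B3). apply Rabs_le_between in A1, A2, A3, B1, B2, B3.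
  repeat split; apply Rabs_le; lra.
Qed.

Lemma ball_bounded3 (p : pt3) : dot3 p p <= 1 -> bounded3 1 p.
Proof.
  destruct p as [[x y] z]; unfold dot3; intro.
  repeat split; apply Rabs_le; nra.
Qed.

Lemma bounded3_sub (a b : R) (p q : pt3) : bounded3 a p -> bounded3 b q -> bounded3 (a + b) (sub3 p q).
Proof.
  destruct p as [[p1 p2] p3], q as [[q1 q2] q3].
  intros (A1 & A2 & A3) (B1 & B2 & B3). apply Rabs_le_between in A1, A2, A3, B1, B2, B3.
  repeat split; apply Rabs_le; lra.
Qed.

Lemma bounded3_dot (a b : R) (p q : pt3) :
  bounded3 a p -> bounded3 b q -> Rabs (dot3 p q) <= 3 * (a * b).
Proof.
  intros Hp Hq.
  assert (H := near3_dot a 0 0 b p (0, 0, 0) q q).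
  replace (dot3 p q - dot3 (0, 0, 0) q) with (dot3 p q) in H
    by (destruct q as [[? ?] ?]; unfold dot3; ring).
  rewrite Rmult_0_l, Rplus_0_r in H. apply H; auto using near3_refl.
  - destruct p as [[p1 p2] p3]; unfold near3, sub3; now rewrite !Rminus_0_r.
  - unfold bounded3. rewrite Rabs_R0. lra.
Qed.

Definition approx3 (v : Z * Z * Z) : pt3 :=
  let '(x, y, z) := v in (IZR x / 10 ^ 6, IZR y / 10 ^ 6, IZR z / 10 ^ 6).

Lemma close3_near3 (p : pt3) (v : Z * Z * Z) : close3 p v -> near3 (6 / 10 ^ 7) p (approx3 v).
Proof. destruct p as [[? ?] ?], v as [[? ?] ?]; exact (fun H => H). Qed.

Lemma approx3_dot (Y : pt3) (v : Z * Z * Z) : dot3 Y (approx3 v) = dot3 Y (toR3 v) / 10 ^ 6.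
Proof. destruct Y as [[? ?] ?], v as [[? ?] ?]; unfold dot3, approx3, toR3; field. Qed.

Lemma approx3_dot2 (v w : Z * Z * Z) : dot3 (approx3 v) (approx3 w) = IZR (dotZ v w) / 10 ^ 12.
Proof. rewrite approx3_dot, dot3_comm, approx3_dot, dot3_comm, dot3_toR3. field. Qed.

Lemma approx3_sub (v w : Z * Z * Z) : sub3 (approx3 v) (approx3 w) = approx3 (subZ v w).
Proof.
  destruct v as [[? ?] ?], w as [[? ?] ?]; unfold sub3, approx3, subZ; izr.
  apply f_equal2; [apply f_equal2|]; field.
Qed.

(** Error budget: about [0.72 / 10 ^ 5] for [<v, w>], [2.16 / 10 ^ 5] for the product
    [<X, v> <X, w>], and a negligible amount for [|w|^2] with its small factor; together less than
    the reserved [3 / 10 ^ 5]. *)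
Lemma slack_transfer (X v q : pt3) (V Q : Z * Z * Z) :
  dot3 X X = 1 -> dot3 v v <= 1 -> dot3 q q <= 1 -> close3 v V -> close3 q Q ->
  dot3 X (toR3 V) * dot3 X (toR3 (subZ V Q)) <= IZR (slackZ V Q) ->
  41 / 50000 * (4 * dot3 (sub3 v q) (sub3 v q) + / 16)
    <= dot3 v (sub3 v q) - dot3 X v * dot3 X (sub3 v q).
Proof.
  intros HX Hv Hq CV CQ HS.
  apply close3_near3 in CV, CQ.
  assert (BX := ball_bounded3 X (Req_le _ _ HX)).
  apply ball_bounded3 in Hv, Hq.
  pose proof (near3_bounded _ _ _ _ CV Hv) as BV.
  pose proof (near3_bounded _ _ _ _ CQ Hq) as BQ.
  pose proof (near3_sub _ _ _ _ _ _ CV CQ) as CW.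
  pose proof (bounded3_sub _ _ _ _ Hv Hq) as Hw.
  pose proof (near3_bounded _ _ _ _ CW Hw) as BW.
  rewrite approx3_sub in CW, BW.
  set (w := sub3 v q) in *. set (W := subZ V Q) in *.
  pose proof (near3_dot _ _ _ _ _ _ _ _ CV CW BV Hw) as E1.
  pose proof (near3_dot _ _ _ _ _ _ _ _ CW CW BW Hw) as E2.
  pose proof (near3_dot _ _ _ _ _ _ _ _ (near3_refl X) CV BX Hv) as E3.
  pose proof (near3_dot _ _ _ _ _ _ _ _ (near3_refl X) CW BX Hw) as E4.
  pose proof (bounded3_dot _ _ _ _ BX BV) as F3.
  pose proof (bounded3_dot _ _ _ _ BX Hw) as F4.
  pose proof (approx_mul _ _ _ _ _ _ _ _ E3 E4 F3 F4) as E5.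
  clear E3 E4 F3 F4.
  rewrite !approx3_dot2 in E1, E2. rewrite !approx3_dot in E5.
  apply Rabs_le_between in E1, E2, E5.
  unfold slackZ in HS. fold W in HS. rewrite minus_IZR, plus_IZR in HS.
  (* Integer division rounds down, and with the sign inside the numerator this is the safe
     direction. *)
  assert (HD : IZR ((- 41 * (64 * dotZ W W + 10 ^ 12)) / 800000)
                <= - 41 * (64 * IZR (dotZ W W) + 10 ^ 12) / 800000).
  { assert (H := Z.mul_div_le (- 41 * (64 * dotZ W W + 10 ^ 12)) 800000 ltac:(lia)).
    apply IZR_le in H. rewrite mult_IZR in H.
    rewrite mult_IZR, plus_IZR, mult_IZR in H.
    replace (IZR (10 ^ 12)) with (10 ^ 12) in H by (rewrite (pow_IZR 10 12); reflexivity).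
    lra. }
  replace (IZR (30 * 10 ^ 6)) with (3 * 10 ^ 7) in HS.
  2:{ change (30 * 10 ^ 6)%Z with 30000000%Z. lra. }
  set (x := dot3 X (toR3 V)) in *. set (y := dot3 X (toR3 W)) in *.
  replace (x / 10 ^ 6 * (y / 10 ^ 6)) with (x * y / 10 ^ 12) in E5 by field.
  lra.
Qed.

(** Rounding moves each coordinate of the cross product by less than [/ 10 ^ 5]. As [X] is
    nonnegative, the inner product moves by at most [/ 10 ^ 5 * sum3 X], the margin of the test. *)
Lemma side_transfer (X v w : pt3) (V W : Z * Z * Z) :
  0 <= fst (fst X) -> 0 <= snd (fst X) -> 0 <= snd X ->
  dot3 v v <= 1 -> dot3 w w <= 1 -> close3 v V -> close3 w W ->
  10 ^ 7 * sum3 X <= dot3 X (toR3 (crossZ V W)) -> 0 <= dot3 X (cross3 v w).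
Proof.
  intros X1 X2 X3 Hv Hw CV CW H.
  apply close3_near3 in CV, CW. apply ball_bounded3 in Hv, Hw.
  pose proof (near3_bounded _ _ _ _ CV Hv) as BV.
  pose proof (near3_bounded _ _ _ _ CW Hw) as BW.
  pose proof (near3_cross _ _ _ _ _ _ _ CV CW BV Hw BW Hv) as C.
  assert (E : dot3 X (cross3 (approx3 V) (approx3 W)) = dot3 X (toR3 (crossZ V W)) / 10 ^ 12).
  { rewrite <- cross3_toR3. destruct X as [[? ?] ?], V as [[? ?] ?], W as [[? ?] ?].
    unfold dot3, cross3, approx3, toR3. field. }
  assert (H' : / 10 ^ 5 * sum3 X <= dot3 X (cross3 (approx3 V) (approx3 W))).
  { rewrite E. lra. }
  clear E H. destruct X as [[x y] z]; cbn [fst snd] in X1, X2, X3.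
  destruct (cross3 v w) as [[a b] c], (cross3 (approx3 V) (approx3 W)) as [[a' b'] c'].
  destruct C as (A1 & A2 & A3). apply Rabs_le_between in A1, A2, A3.
  unfold dot3, sum3 in *.
  assert (0 <= x * (/ 10 ^ 5 - (a' - a))) by (apply Rmult_le_pos; lra).
  assert (0 <= y * (/ 10 ^ 5 - (b' - b))) by (apply Rmult_le_pos; lra).
  assert (0 <= z * (/ 10 ^ 5 - (c' - c))) by (apply Rmult_le_pos; lra).
  lra.
Qed.

Lemma det_transfer (u v w : pt3) (U V W : Z * Z * Z) :
  dot3 u u <= 1 -> dot3 v v <= 1 -> dot3 w w <= 1 -> close3 u U -> close3 v V -> close3 w W ->
  (10 ^ 16 <= dotZ U (crossZ V W))%Z -> 0 < dot3 u (cross3 v w).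
Proof.
  intros Hu Hv Hw CU CV CW H.
  apply close3_near3 in CU, CV, CW. apply ball_bounded3 in Hu, Hv, Hw.
  pose proof (near3_bounded _ _ _ _ CU Hu) as BU.
  pose proof (near3_bounded _ _ _ _ CV Hv) as BV.
  pose proof (near3_bounded _ _ _ _ CW Hw) as BW.
  pose proof (near3_cross _ _ _ _ _ _ _ CV CW BV Hw BW Hv) as C.
  assert (B : bounded3 2 (cross3 v w)).
  { destruct v as [[v1 v2] v3], w as [[w1 w2] w3], Hv as (A1 & A2 & A3), Hw as (B1 & B2 & B3).
    apply Rabs_le_between in A1, A2, A3, B1, B2, B3.
    repeat split; apply Rabs_le; nra. }
  pose proof (near3_dot _ _ _ _ _ _ _ _ CU C BU B) as E.
  assert (E' : dot3 (approx3 U) (cross3 (approx3 V) (approx3 W)) = IZR (dotZ U (crossZ V W)) / 10 ^ 18).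
  { rewrite <- dot3_toR3, <- cross3_toR3. destruct U as [[? ?] ?], V as [[? ?] ?], W as [[? ?] ?].
    unfold dot3, cross3, approx3, toR3. field. }
  rewrite E' in E. apply Rabs_le_between in E.
  apply IZR_le in H. replace (IZR (10 ^ 16)) with (10 ^ 16) in H by (rewrite (pow_IZR 10 16); reflexivity).
  lra.
Qed.

(** * The 30 symmetries of the polyhedron *)

Lemma Rz_add (a b : R) (p : pt3) : Rz a (Rz b p) = Rz (a + b) p.
Proof.
  destruct p as [[x y] z]; unfold Rz. rewrite cos_plus, sin_plus.
  apply f_equal2; [apply f_equal2|]; ring.
Qed.

Lemma Rz_period (n : nat) (p : pt3) : Rz (2 * PI * INR n) p = p.
Proof.
  destruct p as [[x y] z]; unfold Rz.
  replace (2 * PI * INR n) with (0 + 2 * INR n * PI) by ring.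
  rewrite cos_period, sin_period, cos_0, sin_0.
  apply f_equal2; [apply f_equal2|]; ring.
Qed.

Lemma Rz_neg3 (b : R) (p : pt3) : Rz b (neg3 p) = neg3 (Rz b p).
Proof.
  destruct p as [[x y] z]; unfold Rz, neg3. apply f_equal2; [apply f_equal2|]; ring.
Qed.

Lemma neg3_involutive (p : pt3) : neg3 (neg3 p) = p.
Proof. destruct p as [[x y] z]; unfold neg3. apply f_equal2; [apply f_equal2|]; ring. Qed.

Lemma Rz_dot3 (b : R) (p q : pt3) : dot3 (Rz b p) (Rz b q) = dot3 p q.
Proof.
  destruct p as [[x y] z], q as [[x' y'] z']; unfold dot3, Rz.
  pose proof (sin_cos_sq b) as H.
  match goal with |- ?l = _ => replace l with
    ((sin b * sin b + cos b * cos b) * (x * x' + y * y') + z * z') by ring end.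
  rewrite H; ring.
Qed.

Lemma Rz_sub3 (b : R) (p q : pt3) : sub3 (Rz b p) (Rz b q) = Rz b (sub3 p q).
Proof.
  destruct p as [[x y] z], q as [[x' y'] z']; unfold sub3, Rz.
  apply f_equal2; [apply f_equal2|]; ring.
Qed.

(** Admitting every natural [k], by reduction modulo 15, makes closure under rotation a mere
    addition of indices. *)
Lemma in_C30_orbit (d p : pt3) :
  In p (C30_orbit d) <->
  exists k : nat, p = Rz (2 * PI * INR k / 15) d \/ p = neg3 (Rz (2 * PI * INR k / 15) d).
Proof.
  unfold C30_orbit. rewrite in_flat_map. split.
  - intros (k & _ & [<- | [<- | []]]); exists k; auto.
  - intros (k & Hk). exists (k mod 15)%nat. split.
    + apply in_seq. pose proof (Nat.mod_upper_bound k 15). lia.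
    + assert (E : Rz (2 * PI * INR k / 15) d = Rz (2 * PI * INR (k mod 15) / 15) d).
      { rewrite (Nat.div_mod_eq k 15) at 1. rewrite plus_INR, mult_INR.
        replace (2 * PI * (INR 15 * INR (k / 15) + INR (k mod 15)) / 15)
          with (2 * PI * INR (k / 15) + 2 * PI * INR (k mod 15) / 15) by (simpl; field).
        now rewrite <- Rz_add, Rz_period. }
      rewrite E in Hk. destruct Hk as [-> | ->]; cbn; auto.
Qed.

Lemma C30_orbit_neg3 (d p : pt3) : In p (C30_orbit d) -> In (neg3 p) (C30_orbit d).
Proof.
  rewrite !in_C30_orbit. intros (k & [-> | ->]); exists k; [now right | left].
  apply neg3_involutive.
Qed.

Lemma C30_orbit_Rz (d p : pt3) (n : nat) :
  In p (C30_orbit d) -> In (Rz (2 * PI * INR n / 15) p) (C30_orbit d).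
Proof.
  rewrite !in_C30_orbit. intros (k & Hk). exists (n + k)%nat.
  rewrite plus_INR.
  replace (2 * PI * (INR n + INR k) / 15) with (2 * PI * INR n / 15 + 2 * PI * INR k / 15) by field.
  rewrite <- Rz_add. destruct Hk as [-> | ->]; [now left | right]. apply Rz_neg3.
Qed.

Lemma C30_orbit_norm (d p : pt3) : In p (C30_orbit d) -> dot3 p p = dot3 d d.
Proof.
  rewrite in_C30_orbit. intros (k & [-> | ->]).
  - apply Rz_dot3.
  - rewrite <- (Rz_dot3 (2 * PI * INR k / 15) d d).
    destruct (Rz _ d) as [[x y] z]; unfold dot3, neg3; ring.
Qed.

Lemma Ruperthedron_neg3 (p : pt3) : In p Ruperthedron -> In (neg3 p) Ruperthedron.
Proof.
  unfold Ruperthedron. rewrite !in_app_iff.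
  intros [H | [H | H]]; apply C30_orbit_neg3 in H; auto.
Qed.

Lemma Ruperthedron_Rz (p : pt3) (n : nat) :
  In p Ruperthedron -> In (Rz (2 * PI * INR n / 15) p) Ruperthedron.
Proof.
  unfold Ruperthedron. rewrite !in_app_iff.
  intros [H | [H | H]]; apply (C30_orbit_Rz _ _ n) in H; auto.
Qed.

Lemma Ruperthedron_ball (p : pt3) : In p Ruperthedron -> dot3 p p <= 1.
Proof.
  unfold Ruperthedron. rewrite !in_app_iff.
  intros [H | [H | H]]; apply C30_orbit_norm in H; rewrite H; unfold D1, D2, D3, dot3; lra.
Qed.

(** * Soundness of the cover check *)

Definition vert (i : nat) : pt3 := nth i Ruperthedron (0, 0, 0).

Lemma length_Ruperthedron : length Ruperthedron = 90%nat.
Proof. reflexivity. Qed.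

Lemma vert_in (i : nat) : (i < 90)%nat -> In (vert i) Ruperthedron.
Proof. intro H. apply nth_In. now rewrite length_Ruperthedron. Qed.

Lemma in_vert (p : pt3) : In p Ruperthedron -> exists i, (i < 90)%nat /\ p = vert i.
Proof.
  intro H. apply (In_nth _ _ (0, 0, 0)) in H as (i & Hi & E).
  exists i. split; [exact Hi | now rewrite <- E].
Qed.

Lemma Forall2_nth_close3 (P : list pt3) (V : list (Z * Z * Z)) (i : nat) :
  Forall2 close3 P V -> (i < length P)%nat ->
  close3 (nth i P (0, 0, 0)) (nth i V (0, 0, 0)%Z).
Proof.
  intro H. revert i. induction H as [|p v P V Hpv _ IH]; intros [|i] Hi; cbn in *; try lia; auto.
  apply IH; lia.
Qed.

Lemma vert_close3 (i : nat) : (i < 90)%nat -> close3 (vert i) (vertZ i).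
Proof.
  intro Hi. apply Forall2_nth_close3; [exact Forall2_close3 | now rewrite length_Ruperthedron].
Qed.

Lemma vert_ball (i : nat) : (i < 90)%nat -> dot3 (vert i) (vert i) <= 1.
Proof. intro; apply Ruperthedron_ball, vert_in; auto. Qed.

Lemma nth_corner (p : Z * Z * Z) (i : nat) : nth i (snd (mk_corner p)) 0%Z = dotZ p (vertZ i).
Proof.
  unfold vertZ. rewrite <- (map_nth (dotZ p)).
  replace (dotZ p (0, 0, 0)%Z) with 0%Z; [reflexivity|].
  destruct p as [[x y] z]; unfold dotZ; ring.
Qed.

Lemma nth_slack_row (i j : nat) :
  (j < 90)%nat ->
  nth j (slack_row i) 0%Z = if Nat.eqb i j then 0%Z else slackZ (vertZ i) (vertZ j).
Proof.
  intro Hj. unfold slack_row.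
  set (f := fun j => if Nat.eqb i j then 0%Z else slackZ (vertZ i) (vertZ j)).
  rewrite (nth_indep _ _ (f 0%nat)) by now rewrite length_map, length_seq.
  now rewrite map_nth, seq_nth.
Qed.

Definition slack_rows : list (list Z) := map slack_row (seq 0 90).

Lemma nth_slack_rows (i : nat) : (i < 90)%nat -> nth i slack_rows [] = slack_row i.
Proof.
  intro Hi. unfold slack_rows.
  rewrite (nth_indep _ _ (slack_row 0)) by now rewrite length_map, length_seq.
  now rewrite map_nth, seq_nth.
Qed.

Lemma unit_sum3 (X : pt3) :
  0 <= fst (fst X) -> 0 <= snd (fst X) -> 0 <= snd X -> dot3 X X = 1 -> 1 <= sum3 X.
Proof. destruct X as [[x y] z]; unfold dot3, sum3; cbn [fst snd]; nra. Qed.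

Lemma anchor_check_sound (X : pt3) (a b c : R) (p q r : Z * Z * Z) (i : nat) :
  0 <= fst (fst X) -> 0 <= snd (fst X) -> 0 <= snd X -> dot3 X X = 1 ->
  0 <= a -> 0 <= b -> 0 <= c -> cone_comb a b c p q r X ->
  anchor_check slack_rows (mk_corner p) (mk_corner q) (mk_corner r) (min_gram p q r) i = true ->
  (i < 90)%nat /\ anchored Ruperthedron X (vert i).
Proof.
  intros X1 X2 X3 HX Ha Hb Hc HC H. unfold anchor_check in H.
  rewrite !nth_corner in H. cbv zeta in H.
  repeat (apply andb_prop in H as [H ?H]).
  apply Nat.ltb_lt in H. rename H into Hi. split; [exact Hi|].
  apply Z.leb_le in H3, H2, H1.
  rewrite nth_slack_rows in H0 by exact Hi. cbn [fst] in H1, H2, H3.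
  pose proof (cone_comb_linear a b c p q r (vertZ i) X _ _ Ha Hb Hc HC H3 H2 H1) as HV.
  pose proof (unit_sum3 X X1 X2 X3 HX) as Hsum.
  change (10 ^ 6)%Z with 1000000%Z in HV.
  assert (CV := vert_close3 i Hi). assert (BV := vert_ball i Hi).
  split; [now apply vert_in|]. split.
  (* The test gives 0.0005 because [sum3 X >= 1]; rounding costs at most [1.8 / 10 ^ 6], which
     leaves more than [9 / 20000]. *)
  - pose proof (near3_dot _ _ _ _ _ _ _ _ (near3_refl X) (close3_near3 _ _ CV)
      (ball_bounded3 X (Req_le _ _ HX)) (ball_bounded3 _ BV)) as E.
    rewrite approx3_dot in E. apply Rabs_le_between in E. lra.
  - intros q' Hq'. apply in_vert in Hq' as (j & Hj & ->).
    destruct (Nat.eq_dec i j) as [<- | Hij]; [now left | right].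
    apply slack_transfer with (vertZ i) (vertZ j); auto using vert_close3, vert_ball.
    assert (HS := slack_check_sound _ _ _ _ _ _ _ _ _ H0 j).
    rewrite !nth_corner, nth_slack_row in HS by exact Hj.
    apply Nat.eqb_neq in Hij. rewrite Hij in HS. cbv zeta in HS.
    destruct HS as [K1 K2].
    1: unfold slack_row; now rewrite length_map, length_seq.
    1-3: exact Hj.
    assert (Hsub : forall u, (dotZ u (subZ (vertZ i) (vertZ j)) = dotZ u (vertZ i) - dotZ u (vertZ j))%Z).
    { intros [[? ?] ?]. destruct (vertZ i) as [[? ?] ?], (vertZ j) as [[? ?] ?].
      unfold dotZ, subZ; ring. }
    refine (cone_slack a b c p q r _ _ X _ _ _ Ha Hb Hc HC HX _ _ _ _ _ _ _ _ K1 K2);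
      rewrite ?Hsub; try lia.
    lra.
Qed.

(** Cramer's rule for [X] in the basis [u], [v], [w]. The coefficients are the triple products whose
    signs [side_check] controls, divided by the determinant. *)
Lemma cramer3 (X Y u v w : pt3) :
  dot3 u (cross3 v w) * dot3 Y X =
  dot3 X (cross3 v w) * dot3 Y u + dot3 X (cross3 w u) * dot3 Y v + dot3 X (cross3 u v) * dot3 Y w.
Proof.
  destruct X as [[? ?] ?], Y as [[? ?] ?], u as [[? ?] ?], v as [[? ?] ?], w as [[? ?] ?].
  unfold dot3, cross3; ring.
Qed.

Lemma side_check_sound (X : pt3) (a b c : R) (p q r : Z * Z * Z) (i j : nat) :
  0 <= fst (fst X) -> 0 <= snd (fst X) -> 0 <= snd X ->
  0 <= a -> 0 <= b -> 0 <= c -> cone_comb a b c p q r X ->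
  (i < 90)%nat -> (j < 90)%nat ->
  side_check (mk_corner p) (mk_corner q) (mk_corner r) i j = true ->
  0 <= dot3 X (cross3 (vert i) (vert j)).
Proof.
  intros X1 X2 X3 Ha Hb Hc HC Hi Hj H. unfold side_check in H. cbv zeta in H.
  repeat (apply andb_prop in H as [H ?H]). apply Z.leb_le in H, H0, H1. cbn [mk_corner fst] in *.
  apply (side_transfer X _ _ (vertZ i) (vertZ j)); auto using vert_close3, vert_ball.
  rewrite <- (Z.mul_1_l (dotZ p _)) in H. rewrite <- (Z.mul_1_l (dotZ q _)) in H1.
  rewrite <- (Z.mul_1_l (dotZ r _)) in H0.
  pose proof (cone_comb_linear a b c p q r _ X _ _ Ha Hb Hc HC H H1 H0) as HL.
  change (10 ^ 7)%Z with 10000000%Z in HL. lra.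
Qed.

Lemma cover_check_sound (X : pt3) (t : cover) (p q r : Z * Z * Z) :
  0 <= fst (fst X) -> 0 <= snd (fst X) -> 0 <= snd X -> dot3 X X = 1 -> in_cone p q r X ->
  cover_check slack_rows t (mk_corner p) (mk_corner q) (mk_corner r) = true ->
  rigid_view Ruperthedron X.
Proof.
  intros X1 X2 X3 HX. revert p q r.
  induction t as [i j k | l IHl rr IHr]; intros p q r HC H; cbn [cover_check] in H; cbv zeta in H.
  - destruct HC as (a & b & c & Ha & Hb & Hc & HC).
    apply andb_prop in H as [H Ak]. apply andb_prop in H as [H Aj]. apply andb_prop in H as [H Ai].
    apply andb_prop in H as [H HD]. apply andb_prop in H as [H Ski]. apply andb_prop in H as [Sij Sjk].
    apply Z.leb_le in HD.
    apply (anchor_check_sound X a b c) in Ai, Aj, Ak; auto.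
    destruct Ai as [Hi Ai], Aj as [Hj Aj], Ak as [Hk Ak].
    apply (side_check_sound X a b c) in Sij, Sjk, Ski; auto.
    assert (D := det_transfer _ _ _ _ _ _ (vert_ball i Hi) (vert_ball j Hj) (vert_ball k Hk)
      (vert_close3 i Hi) (vert_close3 j Hj) (vert_close3 k Hk) HD).
    set (d := dot3 (vert i) (cross3 (vert j) (vert k))) in *.
    exists (vert i), (vert j), (vert k),
      (dot3 X (cross3 (vert j) (vert k)) / d), (dot3 X (cross3 (vert k) (vert i)) / d),
      (dot3 X (cross3 (vert i) (vert j)) / d).
    split; [auto|]. split.
    + assert (0 <= / d) by (apply Rlt_le, Rinv_0_lt_compat; exact D).
      repeat split; apply Rmult_le_pos; auto.
    + intro Y. pose proof (cramer3 X Y (vert i) (vert j) (vert k)) as E. fold d in E.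
      apply (Rmult_eq_reg_l d); [|lra]. rewrite E. field; lra.
  - rewrite add_corner_mk, !dbl_corner_mk in H. apply andb_prop in H as [H1 H2].
    destruct (in_cone_bisect _ _ _ _ HC) as [HC' | HC']; eauto.
Qed.

(* Found by a greedy computer search: bisect until some triple of vertices passes the test. *)
Definition sector_cover : cover :=
  Node (Node (Node (Node (Node (Node (Node (Node (Leaf 17 36 69) (Leaf 11 36 69)) (Node (Node (Node (Leaf 10 39 17)
  (Node (Leaf 17 36 69) (Leaf 10 39 17))) (Leaf 10 39 17)) (Node (Leaf 10 69 17) (Node (Leaf 17 36 69) (Leaf 10 69
  17))))) (Node (Leaf 17 36 69) (Node (Leaf 11 36 69) (Leaf 17 36 69)))) (Node (Leaf 36 69 83) (Node (Node (Node (Leaf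
  11 36 69) (Node (Leaf 11 36 69) (Leaf 11 36 69))) (Node (Node (Node (Leaf 10 39 17) (Node (Node (Leaf 10 39 17)
  (Node (Leaf 17 36 69) (Leaf 10 39 17))) (Leaf 10 39 17))) (Leaf 10 39 17)) (Node (Node (Node (Leaf 17 36 69) (Leaf
  10 39 17)) (Leaf 17 36 69)) (Node (Node (Leaf 17 36 69) (Node (Leaf 17 36 69) (Leaf 17 36 69))) (Node (Leaf 10 39
  17) (Leaf 17 36 69)))))) (Leaf 11 36 69)))) (Node (Node (Node (Leaf 17 51 22) (Node (Node (Leaf 13 51 22) (Node
  (Leaf 10 39 17) (Leaf 13 51 22))) (Leaf 17 51 22))) (Node (Node (Node (Node (Leaf 12 22 15) (Node (Leaf 12 22 15)
  (Leaf 12 22 15))) (Leaf 12 22 15)) (Leaf 20 41 38)) (Node (Node (Node (Leaf 12 22 15) (Node (Node (Leaf 12 22 15)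
  (Leaf 12 20 15)) (Leaf 12 22 15))) (Leaf 12 22 15)) (Node (Leaf 12 22 15) (Node (Node (Leaf 12 22 15) (Node (Leaf 12
  22 15) (Leaf 12 22 15))) (Leaf 12 22 15)))))) (Node (Node (Node (Leaf 10 22 17) (Leaf 17 51 22)) (Leaf 17 51 22))
  (Node (Leaf 10 39 17) (Node (Leaf 17 51 22) (Leaf 10 22 17)))))) (Node (Node (Node (Node (Node (Node (Leaf 8 37 23)
  (Node (Leaf 8 69 23) (Leaf 8 82 23))) (Leaf 8 37 23)) (Node (Leaf 8 37 51) (Node (Node (Leaf 8 69 23) (Leaf 8 69
  23)) (Leaf 8 37 23)))) (Node (Node (Leaf 36 69 51) (Leaf 11 36 22)) (Node (Node (Node (Leaf 8 82 51) (Leaf 36 82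
  51)) (Leaf 8 82 51)) (Node (Node (Node (Leaf 23 36 69) (Leaf 8 69 23)) (Leaf 23 36 69)) (Node (Leaf 36 69 51) (Node
  (Leaf 8 82 51) (Leaf 36 69 51))))))) (Node (Leaf 23 66 82) (Node (Node (Node (Node (Leaf 23 66 82) (Leaf 8 37 23))
  (Leaf 23 66 82)) (Node (Node (Node (Node (Leaf 37 66 82) (Leaf 8 37 23)) (Leaf 37 66 82)) (Node (Node (Node (Node
  (Node (Leaf 8 37 23) (Node (Node (Leaf 8 37 51) (Node (Leaf 37 66 82) (Leaf 8 37 51))) (Leaf 8 37 23))) (Leaf 8 37
  23)) (Node (Leaf 37 66 82) (Node (Node (Leaf 37 66 82) (Node (Leaf 37 66 82) (Leaf 37 66 82))) (Node (Leaf 8 37 23)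
  (Leaf 37 66 82))))) (Node (Node (Node (Leaf 8 37 51) (Node (Node (Leaf 8 37 51) (Node (Node (Leaf 8 37 51) (Node
  (Leaf 37 66 82) (Node (Leaf 37 66 82) (Leaf 37 66 82)))) (Leaf 8 37 51))) (Leaf 8 37 51))) (Leaf 8 37 51)) (Node
  (Leaf 8 37 51) (Node (Node (Leaf 8 37 51) (Node (Node (Leaf 8 37 51) (Node (Node (Leaf 8 37 51) (Leaf 37 66 82))
  (Leaf 8 37 51))) (Leaf 8 37 51))) (Leaf 8 37 51))))) (Node (Leaf 8 37 23) (Node (Node (Leaf 8 37 23) (Leaf 23 66
  82)) (Leaf 8 37 23))))) (Node (Leaf 8 37 23) (Node (Leaf 23 66 82) (Leaf 8 37 23))))) (Node (Leaf 8 37 23) (Node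
  (Leaf 23 66 82) (Leaf 8 37 23)))))) (Node (Node (Node (Node (Leaf 8 69 83) (Leaf 36 69 51)) (Node (Node (Leaf 8 69
  51) (Leaf 8 37 51)) (Leaf 8 69 83))) (Node (Leaf 8 69 83) (Node (Leaf 36 69 83) (Leaf 8 69 83)))) (Node (Node (Leaf
  23 36 69) (Node (Leaf 11 36 69) (Leaf 36 69 51))) (Node (Node (Node (Leaf 8 69 23) (Node (Leaf 8 69 23) (Leaf 8 69
  23))) (Node (Leaf 8 37 51) (Leaf 8 69 51))) (Leaf 23 36 69)))))) (Node (Node (Node (Node (Node (Leaf 11 68 24) (Node
  (Node (Leaf 11 68 24) (Node (Node (Leaf 11 36 24) (Node (Leaf 11 36 52) (Leaf 11 36 52))) (Leaf 11 68 24))) (Leaf 11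
  68 24))) (Node (Leaf 39 68 52) (Node (Node (Leaf 24 39 68) (Node (Node (Leaf 24 39 68) (Leaf 11 68 24)) (Leaf 24 39
  68))) (Leaf 24 39 68)))) (Node (Node (Node (Leaf 24 69 83) (Leaf 11 83 24)) (Leaf 24 69 83)) (Node (Node (Node (Node
  (Leaf 24 69 83) (Leaf 11 36 24)) (Leaf 24 69 83)) (Node (Node (Node (Node (Node (Leaf 11 36 24) (Node (Node (Leaf 24
  69 83) (Leaf 24 69 83)) (Leaf 11 36 24))) (Leaf 11 36 24)) (Node (Leaf 24 69 83) (Node (Node (Leaf 24 69 83) (Node
  (Leaf 24 69 83) (Leaf 24 69 83))) (Leaf 24 69 83)))) (Node (Node (Node (Node (Node (Leaf 11 36 52) (Leaf 11 36 52))
  (Leaf 11 36 52)) (Node (Node (Node (Node (Leaf 11 36 52) (Node (Node (Leaf 11 36 52) (Node (Node (Leaf 11 36 52)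
  (Leaf 25 36 52)) (Leaf 11 36 52))) (Leaf 11 36 52))) (Leaf 11 36 24)) (Node (Node (Node (Leaf 36 69 83) (Leaf 24 69
  83)) (Leaf 36 69 83)) (Node (Node (Node (Node (Leaf 36 69 83) (Leaf 36 69 83)) (Leaf 36 69 83)) (Node (Node (Node
  (Node (Node (Leaf 36 69 83) (Leaf 25 36 52)) (Node (Leaf 11 36 52) (Node (Leaf 36 69 83) (Leaf 11 36 52)))) (Node
  (Leaf 36 69 83) (Node (Leaf 25 36 52) (Leaf 36 69 83)))) (Node (Leaf 25 36 52) (Node (Leaf 11 36 52) (Leaf 25 36
  52)))) (Node (Leaf 11 36 52) (Node (Node (Leaf 36 69 83) (Leaf 36 69 83)) (Node (Node (Leaf 36 69 83) (Leaf 11 36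
  52)) (Leaf 36 69 83)))))) (Node (Leaf 11 36 52) (Node (Leaf 36 69 83) (Node (Leaf 36 69 83) (Leaf 36 69 83)))))))
  (Node (Node (Node (Leaf 11 36 52) (Leaf 25 36 52)) (Leaf 11 36 52)) (Node (Leaf 11 36 52) (Node (Node (Leaf 11 36
  52) (Node (Node (Leaf 11 36 52) (Leaf 25 36 52)) (Leaf 11 36 52))) (Leaf 11 36 52)))))) (Node (Leaf 11 36 52) (Node
  (Leaf 11 36 52) (Leaf 11 36 52)))) (Node (Leaf 11 36 24) (Node (Node (Leaf 11 36 24) (Node (Node (Leaf 11 36 24)
  (Node (Leaf 24 69 83) (Leaf 24 69 83))) (Leaf 11 36 24))) (Leaf 11 36 24))))) (Node (Leaf 11 36 24) (Node (Node
  (Node (Leaf 11 36 24) (Leaf 24 69 83)) (Leaf 24 69 83)) (Leaf 11 36 24))))) (Node (Node (Leaf 11 36 24) (Node (Leaf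
  11 83 24) (Leaf 11 36 24))) (Node (Leaf 24 69 83) (Leaf 11 36 24)))))) (Node (Node (Node (Node (Leaf 11 68 52) (Leaf
  39 68 52)) (Node (Node (Leaf 11 68 52) (Node (Node (Leaf 11 36 52) (Leaf 11 36 52)) (Leaf 11 36 52))) (Leaf 11 68
  52))) (Node (Leaf 11 68 84) (Node (Leaf 39 68 84) (Leaf 11 68 84)))) (Node (Leaf 39 68 52) (Node (Node (Leaf 11 68
  24) (Node (Node (Leaf 11 68 52) (Node (Node (Leaf 11 36 52) (Leaf 11 36 52)) (Leaf 11 36 52))) (Leaf 11 68 52)))
  (Node (Node (Node (Leaf 24 39 68) (Leaf 11 68 24)) (Leaf 24 39 68)) (Node (Leaf 24 39 68) (Node (Leaf 11 68 24)
  (Leaf 24 39 68)))))))) (Node (Node (Node (Node (Node (Node (Node (Leaf 13 68 52) (Node (Node (Leaf 13 68 52) (Node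
  (Leaf 13 51 22) (Leaf 13 68 52))) (Leaf 13 68 52))) (Leaf 13 68 52)) (Node (Leaf 17 38 52) (Node (Leaf 17 51 22)
  (Leaf 17 68 52)))) (Node (Node (Node (Leaf 10 39 13) (Node (Node (Node (Node (Node (Node (Node (Leaf 10 39 13) (Leaf
  10 39 13)) (Leaf 10 39 13)) (Node (Node (Node (Leaf 13 68 52) (Leaf 10 39 13)) (Leaf 13 68 52)) (Node (Leaf 13 51
  22) (Node (Leaf 10 39 13) (Leaf 13 51 22))))) (Node (Leaf 10 22 13) (Node (Leaf 10 39 13) (Leaf 10 39 13)))) (Node
  (Leaf 10 39 13) (Node (Node (Leaf 10 39 13) (Leaf 13 68 52)) (Leaf 10 39 13)))) (Leaf 13 51 22)) (Node (Leaf 10 39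
  13) (Node (Leaf 10 39 13) (Leaf 10 39 13))))) (Leaf 10 39 17)) (Node (Leaf 10 39 13) (Node (Node (Leaf 13 68 52)
  (Node (Node (Leaf 13 68 52) (Leaf 13 51 22)) (Node (Node (Leaf 13 68 52) (Leaf 10 39 13)) (Leaf 13 68 52)))) (Leaf
  10 39 13))))) (Node (Leaf 13 68 52) (Node (Leaf 17 38 52) (Leaf 13 68 52)))) (Node (Node (Leaf 12 22 15) (Node (Node
  (Leaf 12 22 17) (Leaf 20 41 38)) (Leaf 12 22 15))) (Node (Node (Leaf 17 51 22) (Node (Node (Node (Leaf 10 39 13)
  (Leaf 13 51 22)) (Leaf 10 39 17)) (Node (Node (Node (Leaf 13 51 22) (Leaf 10 39 13)) (Leaf 13 51 22)) (Node (Leaf 13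
  51 22) (Node (Leaf 10 39 13) (Leaf 13 51 22)))))) (Leaf 17 51 22)))) (Node (Node (Node (Node (Node (Node (Leaf 11 83
  52) (Leaf 23 83 52)) (Leaf 11 36 69)) (Node (Leaf 11 83 24) (Node (Node (Leaf 23 83 52) (Leaf 23 83 52)) (Leaf 11 83
  52)))) (Node (Node (Node (Node (Leaf 10 39 23) (Node (Node (Leaf 10 39 17) (Node (Node (Node (Leaf 17 36 69) (Leaf
  10 39 17)) (Leaf 17 36 69)) (Node (Node (Node (Node (Leaf 17 36 69) (Leaf 10 39 17)) (Leaf 17 36 69)) (Node (Leaf 17
  36 69) (Node (Leaf 10 39 17) (Leaf 17 36 69)))) (Node (Leaf 10 39 17) (Node (Leaf 17 36 69) (Leaf 10 39 17))))))
  (Leaf 10 39 23))) (Leaf 10 39 23)) (Node (Leaf 10 39 17) (Node (Node (Leaf 10 39 17) (Node (Node (Leaf 10 39 17)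
  (Node (Leaf 17 36 69) (Leaf 10 39 17))) (Leaf 10 39 17))) (Leaf 10 39 17)))) (Node (Node (Leaf 11 36 69) (Leaf 11 36
  69)) (Node (Leaf 23 83 52) (Node (Node (Node (Node (Leaf 17 36 69) (Leaf 11 36 52)) (Node (Leaf 23 83 52) (Node
  (Node (Leaf 17 83 52) (Node (Node (Leaf 17 36 52) (Leaf 17 36 69)) (Leaf 17 83 52))) (Leaf 17 83 52)))) (Node (Leaf
  17 36 69) (Node (Leaf 11 36 69) (Leaf 17 36 69)))) (Node (Leaf 11 36 52) (Node (Leaf 23 83 52) (Leaf 11 36
  52)))))))) (Node (Leaf 36 69 83) (Node (Node (Leaf 24 69 83) (Leaf 11 83 24)) (Leaf 36 69 83)))) (Node (Node (Node
  (Leaf 10 39 68) (Node (Node (Leaf 39 68 52) (Node (Leaf 11 68 24) (Leaf 24 39 68))) (Leaf 10 39 68))) (Leaf 39 68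
  52)) (Node (Leaf 10 39 23) (Node (Node (Leaf 39 68 52) (Node (Leaf 11 68 24) (Leaf 39 68 52))) (Leaf 10 39
  23)))))))) (Node (Node (Node (Node (Node (Node (Leaf 47 68 48) (Node (Leaf 16 41 38) (Leaf 47 68 50))) (Node (Node
  (Leaf 40 71 68) (Node (Node (Leaf 40 71 68) (Node (Leaf 42 84 68) (Leaf 42 71 68))) (Leaf 40 71 68))) (Node (Leaf 40
  82 81) (Node (Leaf 40 48 45) (Leaf 40 82 81))))) (Node (Node (Node (Node (Leaf 16 41 38) (Leaf 16 41 38)) (Leaf 38
  48 47)) (Node (Leaf 14 48 47) (Node (Node (Node (Node (Leaf 12 69 47) (Leaf 14 41 38)) (Leaf 12 69 47)) (Node (Node
  (Node (Node (Leaf 12 50 49) (Leaf 12 41 38)) (Leaf 12 50 49)) (Node (Leaf 12 50 49) (Node (Leaf 12 41 38) (Leaf 12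
  50 49)))) (Node (Leaf 14 41 38) (Leaf 12 69 47)))) (Leaf 14 48 47)))) (Node (Leaf 16 41 38) (Node (Leaf 38 48 47)
  (Leaf 16 41 38))))) (Node (Node (Leaf 49 83 50) (Node (Node (Leaf 16 50 49) (Node (Leaf 14 41 38) (Leaf 16 50 49)))
  (Leaf 49 83 50))) (Node (Node (Leaf 40 71 83) (Node (Node (Leaf 42 71 68) (Node (Leaf 42 84 68) (Leaf 42 71 68)))
  (Node (Leaf 40 71 68) (Leaf 40 71 68)))) (Node (Node (Leaf 43 68 50) (Leaf 16 41 38)) (Leaf 43 83 50))))) (Node
  (Node (Node (Node (Node (Leaf 68 82 79) (Leaf 68 82 75)) (Leaf 68 82 71)) (Node (Node (Leaf 68 82 81) (Leaf 46 73
  68)) (Node (Leaf 68 70 84) (Leaf 68 82 81)))) (Node (Leaf 68 70 84) (Node (Node (Leaf 66 68 82) (Leaf 68 80 71))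
  (Leaf 68 80 75)))) (Node (Node (Node (Leaf 48 82 81) (Node (Node (Leaf 40 82 81) (Node (Leaf 40 71 66) (Leaf 40 82
  79))) (Leaf 46 82 81))) (Node (Leaf 48 69 81) (Node (Leaf 38 82 81) (Leaf 38 69 81)))) (Node (Node (Leaf 68 82 81)
  (Node (Node (Leaf 42 71 68) (Node (Node (Leaf 42 71 68) (Leaf 42 84 68)) (Leaf 42 71 68))) (Leaf 42 71 68))) (Node
  (Node (Leaf 42 82 81) (Node (Leaf 40 71 68) (Leaf 40 82 81))) (Leaf 68 82 81)))))) (Node (Node (Node (Node (Node
  (Node (Leaf 21 36 50) (Leaf 10 50 13)) (Node (Node (Leaf 21 36 50) (Node (Leaf 11 66 50) (Leaf 11 36 50))) (Leaf 21
  36 50))) (Node (Node (Node (Leaf 17 36 50) (Leaf 17 36 22)) (Leaf 17 36 69)) (Node (Leaf 10 50 13) (Leaf 21 36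
  50)))) (Node (Node (Leaf 15 36 20) (Node (Leaf 12 39 36) (Leaf 10 20 15))) (Node (Node (Leaf 15 36 82) (Node (Node
  (Leaf 17 36 50) (Leaf 11 66 50)) (Leaf 17 36 50))) (Leaf 10 82 13)))) (Node (Node (Node (Node (Leaf 8 37 66) (Node
  (Leaf 8 37 66) (Leaf 8 37 66))) (Leaf 37 66 50)) (Node (Node (Leaf 37 66 82) (Leaf 9 66 82)) (Leaf 37 66 82))) (Node
  (Node (Node (Leaf 11 36 22) (Node (Node (Node (Leaf 8 82 51) (Node (Leaf 8 22 11) (Node (Node (Node (Leaf 8 37 51)
  (Node (Leaf 8 22 11) (Node (Leaf 8 37 66) (Node (Leaf 8 37 51) (Leaf 8 37 66))))) (Leaf 8 37 51)) (Node (Leaf 8 82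
  51) (Node (Leaf 8 22 11) (Leaf 8 82 51)))))) (Leaf 8 82 51)) (Node (Leaf 22 82 51) (Node (Leaf 11 36 22) (Leaf 22 82
  51))))) (Leaf 11 36 22)) (Node (Node (Node (Node (Leaf 11 36 22) (Node (Node (Leaf 11 66 22) (Leaf 8 22 11)) (Node
  (Node (Leaf 11 66 22) (Leaf 11 36 22)) (Leaf 11 66 22)))) (Leaf 11 36 22)) (Node (Leaf 11 66 50) (Node (Node (Leaf
  11 66 22) (Node (Leaf 8 22 11) (Leaf 11 66 22))) (Leaf 11 66 22)))) (Node (Node (Node (Node (Leaf 8 37 66) (Node
  (Node (Node (Leaf 8 22 11) (Node (Leaf 8 37 66) (Leaf 8 22 11))) (Leaf 8 22 11)) (Node (Leaf 8 22 11) (Node (Leaf 8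
  37 66) (Leaf 8 22 11))))) (Leaf 8 37 66)) (Node (Leaf 8 37 66) (Node (Node (Node (Node (Node (Leaf 8 37 66) (Node
  (Leaf 8 37 66) (Leaf 8 37 66))) (Leaf 8 37 66)) (Leaf 8 37 66)) (Node (Leaf 8 22 11) (Node (Node (Leaf 8 22 11)
  (Leaf 8 22 11)) (Leaf 8 22 11)))) (Leaf 8 37 66)))) (Node (Leaf 11 36 22) (Node (Node (Node (Leaf 11 66 22) (Node
  (Leaf 11 36 22) (Leaf 11 66 22))) (Leaf 8 22 11)) (Node (Node (Node (Leaf 11 36 22) (Leaf 8 22 11)) (Leaf 11 36 22))
  (Node (Leaf 11 36 22) (Node (Leaf 11 66 22) (Leaf 11 36 22))))))))))) (Node (Node (Node (Node (Node (Leaf 15 83 50)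
  (Node (Node (Leaf 15 83 50) (Node (Leaf 15 83 22) (Leaf 15 83 50))) (Leaf 15 83 50))) (Node (Leaf 12 50 49) (Leaf 15
  83 20))) (Node (Node (Node (Leaf 10 22 13) (Leaf 13 83 50)) (Leaf 17 83 22)) (Node (Node (Node (Node (Leaf 13 83 22)
  (Leaf 13 83 50)) (Leaf 10 22 13)) (Node (Leaf 15 83 22) (Node (Leaf 13 83 50) (Leaf 13 83 22)))) (Node (Leaf 13 83
  50) (Node (Leaf 10 22 13) (Leaf 13 83 50)))))) (Node (Node (Node (Node (Leaf 12 20 17) (Node (Leaf 14 41 38) (Leaf
  12 20 17))) (Node (Node (Leaf 12 50 15) (Node (Node (Node (Leaf 12 22 15) (Leaf 12 50 15)) (Leaf 12 22 15)) (Node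
  (Leaf 12 22 15) (Node (Leaf 12 50 15) (Leaf 12 22 15))))) (Leaf 12 50 15))) (Leaf 20 41 38)) (Node (Leaf 20 50 49)
  (Node (Node (Leaf 12 20 15) (Node (Node (Leaf 12 50 15) (Node (Leaf 12 22 15) (Leaf 12 50 15))) (Leaf 12 20 15)))
  (Node (Node (Leaf 12 20 17) (Leaf 14 41 38)) (Leaf 12 20 17)))))) (Node (Node (Node (Node (Leaf 12 50 49) (Leaf 15
  49 20)) (Leaf 12 50 49)) (Node (Node (Node (Leaf 12 39 36) (Node (Leaf 12 50 49) (Node (Node (Node (Node (Node (Leaf
  12 39 49) (Node (Leaf 12 50 47) (Leaf 12 39 49))) (Leaf 12 39 49)) (Node (Leaf 12 50 49) (Node (Leaf 12 50 47) (Leaf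
  12 50 49)))) (Node (Leaf 12 69 47) (Node (Leaf 12 39 36) (Node (Node (Leaf 12 39 49) (Leaf 12 50 47)) (Leaf 12 39
  36))))) (Leaf 12 50 49)))) (Leaf 12 39 36)) (Node (Leaf 15 49 20) (Leaf 12 50 49)))) (Node (Node (Node (Node (Leaf
  10 39 13) (Leaf 10 39 13)) (Leaf 10 39 13)) (Node (Leaf 17 36 69) (Node (Node (Leaf 10 39 13) (Leaf 10 39 13)) (Leaf
  10 39 13)))) (Node (Node (Node (Leaf 12 20 15) (Node (Node (Leaf 15 49 20) (Node (Node (Leaf 15 49 20) (Node (Node
  (Leaf 13 49 20) (Node (Leaf 10 20 13) (Leaf 13 49 20))) (Leaf 15 49 20))) (Leaf 15 49 20))) (Leaf 12 20 15))) (Leaf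
  12 50 49)) (Node (Leaf 15 49 20) (Node (Node (Leaf 15 49 20) (Node (Node (Leaf 15 49 20) (Node (Node (Leaf 13 49 20)
  (Node (Leaf 10 20 13) (Leaf 13 49 20))) (Leaf 15 49 20))) (Leaf 15 49 20))) (Leaf 15 49 20))))))))).

Lemma sector_cover_check :
  cover_check slack_rows sector_cover
    (mk_corner (20, 9, 0)%Z) (mk_corner (0, 0, 20)%Z) (mk_corner (20, 0, 0)%Z) = true.
Proof. vm_cast_no_check (eq_refl true). Qed.

(** * Reduction of the sphere to one sector *)

Lemma polar (x y : R) :
  exists r t, 0 <= r /\ 0 <= t < 2 * PI /\ x = r * cos t /\ y = r * sin t.
Proof.
  pose proof PI_RGT_0 as Hpi.
  set (r := sqrt (x * x + y * y)).
  assert (Hr : r * r = x * x + y * y) by (apply sqrt_sqrt; nra).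
  assert (Hr0 : 0 <= r) by apply sqrt_pos.
  destruct (Req_dec r 0) as [E | E].
  - exists 0, 0. rewrite E, Rmult_0_l in Hr. symmetry in Hr.
    destruct (Rplus_sqr_eq_0 _ _ Hr) as [-> ->]. repeat split; lra.
  - assert (Hrp : 0 < r) by (destruct Hr0; [auto | congruence]).
    assert (Hc : (x / r) ^ 2 + (y / r) ^ 2 = 1).
    { replace ((x / r) ^ 2 + (y / r) ^ 2) with ((x * x + y * y) / (r * r)) by (field; lra).
      rewrite Hr. field. rewrite <- Hr. nra. }
    set (c := x / r) in *. set (s := y / r) in *.
    assert (Hx : x = r * c) by (unfold c; field; lra).
    assert (Hy : y = r * s) by (unfold s; field; lra).
    assert (Hcb : -1 <= c <= 1) by nra.
    pose proof (acos_bound c) as [B1 B2].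
    assert (Hs : sin (acos c) = Rabs s).
    { rewrite sin_acos by exact Hcb. rewrite <- sqrt_Rsqr_abs. f_equal. unfold Rsqr. lra. }
    destruct (Rle_or_lt 0 s) as [H | H].
    + exists r, (acos c). rewrite Hs, cos_acos, Rabs_right by (auto; lra). repeat split; auto; lra.
    + exists r, (2 * PI - acos c).
      assert (acos c <> 0).
      { intro E0. rewrite E0, sin_0 in Hs. symmetry in Hs. revert Hs. apply Rabs_no_R0; lra. }
      rewrite cos_minus, sin_minus, cos_2PI, sin_2PI, Hs, cos_acos, Rabs_left by (auto; lra).
      repeat split; try lra.
Qed.

(** The corner [(20, 9, 0)] lies slightly beyond the sector, since [tan (2 PI / 15)], about 0.4452,
    is less than [9 / 20]; this gives the triangle small integer corners. *)
Lemma sector_in_cone (r t z : R) :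
  0 <= r -> 0 <= z -> 0 <= t <= 2 * PI / 15 ->
  in_cone (20, 9, 0)%Z (0, 0, 20)%Z (20, 0, 0)%Z (r * cos t, r * sin t, z).
Proof.
  intros Hr Hz Ht. pose proof PI_RGT_0.
  destruct cos_24_bounds as [Hc Hs]. apply Rabs_le_between in Hc, Hs.
  assert (cos (2 * PI / 15) <= cos t) by (apply cos_decr_1; lra).
  assert (sin t <= sin (2 * PI / 15)) by (apply sin_incr_1; lra).
  assert (0 <= sin t) by (apply sin_ge_0; lra).
  exists (r * sin t / 9), (z / 20), ((r * cos t - 20 / 9 * (r * sin t)) / 20).
  assert (0 <= r * sin t) by (apply Rmult_le_pos; auto).
  assert (0 <= r * (cos t - 20 / 9 * sin t)) by (apply Rmult_le_pos; lra).
  repeat split; try lra.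
  intros [[a b] c]. unfold dot3, toR3. field.
Qed.

Lemma sphere_rigid_view (X : pt3) : dot3 X X = 1 -> rigid_view Ruperthedron X.
Proof.
  assert (Hup : forall x y z, 0 <= z -> dot3 (x, y, z) (x, y, z) = 1 ->
            rigid_view Ruperthedron (x, y, z)).
  { clear X. intros x y z Hz HX. pose proof PI_RGT_0 as Hpi.
    destruct (polar x y) as (r & t & Hr & Ht & Ex & Ey).
    destruct (nfloor_ex (t / (2 * PI / 15))) as [n Hn].
    { apply Rdiv_le_0_compat; lra. }
    set (b := 2 * PI * INR n / 15).
    assert (Hb : 0 <= t - b <= 2 * PI / 15).
    { assert (E : t = t / (2 * PI / 15) * (2 * PI / 15)) by (field; lra).
      set (s := t / (2 * PI / 15)) in *. clearbody s. rewrite E. unfold b.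
      replace (2 * PI * INR n / 15) with (INR n * (2 * PI / 15)) by field.
      assert (0 < 2 * PI / 15) by lra. split; nra. }
    assert (EX : (x, y, z) = Rz b (r * cos (t - b), r * sin (t - b), z)).
    { unfold Rz. rewrite Ex, Ey. replace t with (b + (t - b)) at 1 2 by ring.
      rewrite cos_plus, sin_plus. apply f_equal2; [apply f_equal2|]; ring. }
    rewrite EX. rewrite EX, Rz_dot3 in HX.
    (* Rotating back by [n] steps is rotating forward by [14 * n] steps, so natural indices
       suffice. *)
    assert (Hinv : forall p, Rz b (Rz (2 * PI * INR (14 * n) / 15) p) = p).
    { intro p. rewrite Rz_add, mult_INR.
      replace (b + 2 * PI * (INR 14 * INR n) / 15) with (2 * PI * INR n)
        by (unfold b; simpl (INR 14); field).
      apply Rz_period. }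
    apply (rigid_view_isometry _ (Rz b) (Rz (2 * PI * INR (14 * n) / 15)));
      auto using Rz_dot3, Rz_sub3, Ruperthedron_Rz.
    { intros; apply Ruperthedron_Rz; auto. }
    assert (0 <= cos (t - b)) by (apply cos_ge_0; lra).
    assert (0 <= sin (t - b)) by (apply sin_ge_0; lra).
    apply (cover_check_sound _ sector_cover (20, 9, 0)%Z (0, 0, 20)%Z (20, 0, 0)%Z).
    1-2: apply Rmult_le_pos; auto.
    1-2: auto.
    - now apply sector_in_cone.
    - exact sector_cover_check. }
  destruct X as [[x y] z]. intro HX. destruct (Rle_or_lt 0 z); [auto|].
  replace ((x, y, z) : pt3) with (neg3 (- x, - y, - z))
    by (unfold neg3; now rewrite !Ropp_involutive).
  apply (rigid_view_isometry _ neg3 neg3).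
  - intros [[? ?] ?] [[? ?] ?]; unfold dot3, neg3; ring.
  - intros [[? ?] ?] [[? ?] ?]; unfold sub3, neg3. apply f_equal2; [apply f_equal2|]; ring.
  - exact neg3_involutive.
  - exact Ruperthedron_neg3.
  - exact Ruperthedron_neg3.
  - apply Hup; [lra|]. rewrite <- HX. unfold dot3; ring.
Qed.

Lemma Ruperthedron_rigid (th1 ph1 th2 ph2 a : R) :
  Rabs (th1 - th2) <= 6 / 10000 -> Rabs (ph1 - ph2) <= 6 / 10000 -> Rabs a <= 6 / 10000 ->
  ~ rupert_cond Ruperthedron 1 th1 ph1 th2 ph2 a.
Proof.
  intros. apply rigid_view_no_rupert;
    auto using Ruperthedron_ball, Ruperthedron_neg3, sphere_rigid_view, view_norm.
Qed.

(** * The passage *)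

(** [in_conv] with a free total weight, so that combinations can be built by induction on [Q]; total
    weight 1 gives [in_conv] by conversion. *)
Definition weighted (Q : list pt2) (s : R) (x : pt2) : Prop :=
  exists w : list R, length w = length Q /\ List.Forall (fun a => 0 <= a) w /\
    fold_right Rplus 0 w = s /\ wsum w Q = x.

Lemma weighted_comb (Q : list pt2) (l m s t : R) (x y : pt2) :
  0 <= l -> 0 <= m -> weighted Q s x -> weighted Q t y ->
  weighted Q (l * s + m * t) (l * fst x + m * fst y, l * snd x + m * snd y).
Proof.
  intros Hl Hm (w & Lw & Pw & <- & <-) (w' & Lw' & Pw' & <- & <-).
  revert w w' Lw Pw Lw' Pw'.
  induction Q as [|[u v] Q IH]; intros [|a w] [|b w'] Lw Pw Lw' Pw'; try discriminate.
  - exists []. cbn. repeat split; auto; [ring | f_equal; ring].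
  - inversion_clear Pw as [|? ? Ha Pw0]. inversion_clear Pw' as [|? ? Hb Pw0'].
    destruct (IH w w') as (z & Lz & Pz & Sz & Wz); auto.
    exists (l * a + m * b :: z). cbn. repeat split.
    + now rewrite Lz.
    + constructor; [nra | auto].
    + rewrite Sz; ring.
    + rewrite Wz. destruct (wsum w Q), (wsum w' Q). cbn. f_equal; ring.
Qed.

Lemma weighted_zero (Q : list pt2) : weighted Q 0 (0, 0).
Proof.
  induction Q as [|[u v] Q (w & L & P & S & W)].
  - exists []. cbn. auto.
  - exists (0 :: w). cbn. repeat split; auto.
    + constructor; [lra | auto].
    + rewrite S; ring.
    + rewrite W. f_equal; ring.
Qed.

Lemma weighted_vertex (Q : list pt2) (q : pt2) : In q Q -> weighted Q 1 q.
Proof.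
  induction Q as [|[u v] Q IH]; [intros [] | intros [<- | H]].
  - destruct (weighted_zero Q) as (w & L & P & S & W).
    exists (1 :: w). cbn. repeat split; auto.
    + constructor; [lra | auto].
    + rewrite S; ring.
    + rewrite W. f_equal; ring.
  - destruct (IH H) as (w & L & P & S & W).
    exists (0 :: w). cbn. repeat split; auto.
    + constructor; [lra | auto].
    + rewrite S; ring.
    + rewrite W. destruct q. f_equal; ring.
Qed.

Lemma in_conv_comb (Q : list pt2) (l m : R) (x y : pt2) :
  0 <= l -> 0 <= m -> l + m = 1 -> in_conv Q x -> in_conv Q y ->
  in_conv Q (l * fst x + m * fst y, l * snd x + m * snd y).
Proof.
  intros Hl Hm E Hx Hy. change (weighted Q 1 (l * fst x + m * fst y, l * snd x + m * snd y)).
  replace 1 with (l * 1 + m * 1) by lra. now apply weighted_comb.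
Qed.

Definition orient (y a b : pt2) : R :=
  (fst a - fst y) * (snd b - snd y) - (snd a - snd y) * (fst b - fst y).

(** The barycentric coordinates of [y] are ratios of areas: the weight of each corner is the
    oriented area spanned by [y] and the other two, over the total [d]. *)
Lemma triangle_in_conv (Q : list pt2) (a b c y : pt2) :
  In a Q -> In b Q -> In c Q ->
  0 < orient y a b -> 0 < orient y b c -> 0 < orient y c a -> in_conv Q y.
Proof.
  intros Ha Hb Hc Hab Hbc Hca.
  set (d := orient y a b + orient y b c + orient y c a).
  assert (Hd : 0 < d) by (unfold d; lra).
  assert (Hd' : 0 <= / d) by (apply Rlt_le, Rinv_0_lt_compat; exact Hd).
  assert (H := weighted_comb Q 1 (orient y a b / d) _ _ _ _ Rle_0_1
    (Rmult_le_pos _ _ (Rlt_le _ _ Hab) Hd')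
    (weighted_comb Q (orient y b c / d) (orient y c a / d) _ _ _ _
       (Rmult_le_pos _ _ (Rlt_le _ _ Hbc) Hd') (Rmult_le_pos _ _ (Rlt_le _ _ Hca) Hd')
       (weighted_vertex Q a Ha) (weighted_vertex Q b Hb))
    (weighted_vertex Q c Hc)).
  cbn [fst snd] in H.
  match type of H with weighted _ ?s ?x =>
    replace s with 1 in H; [replace x with y in H; [exact H|]|] end.
  - destruct y as [y1 y2], a as [a1 a2], b as [b1 b2], c as [c1 c2].
    unfold d, orient in *; cbn [fst snd] in *.
    f_equal; field; lra.
  - unfold d; field. fold d. lra.
Qed.

Lemma in_int_conv_shrink (Q : list pt2) (x : pt2) (t : R) :
  0 < t <= 1 -> in_conv Q (0, 0) -> in_int_conv Q x -> in_int_conv Q (t * fst x, t * snd x).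
Proof.
  intros Ht H0 (e & He & Hx). exists (t * e). split; [nra|].
  intros [y1 y2] Hy. cbn [fst snd] in Hy.
  assert (HC : in_conv Q (y1 / t, y2 / t)).
  { apply Hx. cbn [fst snd].
    replace ((y1 / t - fst x) ^ 2 + (y2 / t - snd x) ^ 2)
      with (((y1 - t * fst x) ^ 2 + (y2 - t * snd x) ^ 2) / t ^ 2) by (field; lra).
    apply Rmult_lt_reg_r with (t ^ 2); [nra|].
    replace (((y1 - t * fst x) ^ 2 + (y2 - t * snd x) ^ 2) / t ^ 2 * t ^ 2)
      with ((y1 - t * fst x) ^ 2 + (y2 - t * snd x) ^ 2) by (field; lra).
    lra. }
  assert (H := in_conv_comb Q t (1 - t) _ _ ltac:(lra) ltac:(lra) ltac:(lra) HC H0).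
  cbn [fst snd] in H.
  replace ((y1, y2) : pt2) with (t * (y1 / t) + (1 - t) * 0, t * (y2 / t) + (1 - t) * 0); [exact H|].
  f_equal; field; lra.
Qed.

(** By central symmetry the origin is the midpoint of two projected vertices, so contracting towards
    it preserves interior points. A passage with factor 1.003 thus also gives Rupert's property. *)
Lemma rupert_cond_shrink (P : list pt3) (s s' th1 ph1 th2 ph2 a : R) :
  0 < s' <= s -> (forall p, In p P -> In (neg3 p) P) ->
  rupert_cond P s th1 ph1 th2 ph2 a -> rupert_cond P s' th1 ph1 th2 ph2 a.
Proof.
  intros Hs Hneg H p Hp. specialize (H p Hp).
  assert (H0 : in_conv (map (Mproj th2 ph2) P) (0, 0)).
  { pose proof (in_conv_comb _ (/ 2) (/ 2) _ _ ltac:(lra) ltac:(lra) ltac:(lra)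
      (weighted_vertex _ _ (in_map (Mproj th2 ph2) _ _ Hp))
      (weighted_vertex _ _ (in_map (Mproj th2 ph2) _ _ (Hneg p Hp)))) as HC.
    match type of HC with in_conv _ ?x => replace x with ((0, 0) : pt2) in HC; [exact HC|] end.
    destruct p as [[x y] z]. unfold Mproj, neg3. cbn [fst snd]. f_equal; field. }
  apply (in_int_conv_shrink _ _ (s' / s)) in H; auto.
  - destruct (Rot a (Mproj th1 ph1 p)) as [u v]. unfold scale2 in *. cbn [fst snd] in H.
    replace (s' * u, s' * v) with (s' / s * (s * u), s' / s * (s * v)); [exact H|].
    f_equal; field; lra.
  - split; [apply Rdiv_lt_0_compat; lra|]. apply Rmult_le_reg_r with s; [lra|].
    replace (s' / s * s) with s' by (field; lra). lra.
Qed.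

(** The rational parametrisation of the circle, with [x = 2 * atan t]: all entries of the matrices
    become exact rationals. *)
Lemma tan_half_angle (t : R) :
  0 < t -> exists x, 0 <= x < PI /\ cos x = (1 - t * t) / (1 + t * t) /\ sin x = 2 * t / (1 + t * t).
Proof.
  intro Ht. exists (2 * atan t).
  pose proof (atan_bound t). pose proof (atan_increasing 0 t Ht) as Hi. rewrite atan_0 in Hi.
  assert (Hs : 0 < sqrt (1 + t²)) by (apply sqrt_lt_R0; unfold Rsqr; nra).
  assert (Hss : sqrt (1 + t²) * sqrt (1 + t²) = 1 + t * t) by (apply sqrt_sqrt; unfold Rsqr; nra).
  split; [lra|].
  rewrite cos_2a, sin_2a, sin_atan, cos_atan, <- Hss.
  split; [|field; lra].
  replace (1 - t * t) with (1 + 1 - (1 + t * t)) by ring. rewrite <- Hss.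
  set (r := sqrt _) in *. replace (t / r * (t / r)) with ((1 + t * t - 1) / (r * r)) by (field; lra).
  rewrite <- Hss. field; lra.
Qed.

Definition projZ (r s : Z * Z * Z) (i : nat) : Z * Z := (dotZ r (vertZ i), dotZ s (vertZ i)).

Definition orientZ (y a b : Z * Z) : Z :=
  ((fst a - fst y) * (snd b - snd y) - (snd a - snd y) * (fst b - fst y))%Z.

Definition triangle_check (y a b c : Z * Z) : bool :=
  (10 ^ 20 <=? orientZ y a b)%Z && (10 ^ 20 <=? orientZ y b c)%Z && (10 ^ 20 <=? orientZ y c a)%Z.

(** The outer polygon is cut into a fan of triangles with apex [k] over consecutive entries of [l].
    At scale [10 ^ 24] for areas, each orientation has margin [/ 10 ^ 4]. *)
Definition fan_check (r s r' s' : Z * Z * Z) (k : nat) (l : list nat) : bool :=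
  forallb (fun i =>
    let y := projZ r s i in
    existsb (fun jj => triangle_check y (projZ r' s' k) (projZ r' s' (fst jj)) (projZ r' s' (snd jj)))
      (combine l (tl l))) (seq 0 90).

(** A common form for the outer projection and for the scaled and rotated inner one. *)
Definition proj_rows (r s : pt3) (p : pt3) : pt2 := (dot3 r p, dot3 s p).

Definition approx2 (v : Z * Z) : pt2 := (IZR (fst v) / 10 ^ 12, IZR (snd v) / 10 ^ 12).

Definition near2 (e : R) (p q : pt2) : Prop :=
  Rabs (fst p - fst q) <= e /\ Rabs (snd p - snd q) <= e.

(** The bound [102 / 100] leaves room for the inner rows, which carry the factor [1003 / 1000]. *)
Lemma row_bounded (r p : pt3) : dot3 r r <= 102 / 100 -> dot3 p p <= 1 -> Rabs (dot3 r p) <= 101 / 100.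
Proof.
  intros Hr Hp. pose proof (Cauchy3 r p). pose proof (dot3_nonneg r). pose proof (dot3_nonneg p).
  assert (dot3 r p ^ 2 <= 102 / 100) by nra.
  apply Rabs_le; nra.
Qed.

Lemma row_near (r : pt3) (rZ : Z * Z * Z) (i : nat) :
  close3 r rZ -> dot3 r r <= 102 / 100 -> (i < 90)%nat ->
  Rabs (dot3 r (vert i) - IZR (dotZ rZ (vertZ i)) / 10 ^ 12) <= 37 / 10 ^ 7.
Proof.
  intros Hr Hn Hi.
  assert (Hb : bounded3 (101 / 100) r).
  { destruct r as [[x y] z]; unfold dot3 in Hn. repeat split; apply Rabs_le; nra. }
  apply close3_near3 in Hr. pose proof (near3_bounded _ _ _ _ Hr Hb) as Hb'.
  pose proof (near3_dot _ _ _ _ _ _ _ _ Hr (close3_near3 _ _ (vert_close3 i Hi)) Hb'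
    (ball_bounded3 _ (vert_ball i Hi))) as H.
  rewrite approx3_dot2 in H. lra.
Qed.

Lemma proj_near (r s : pt3) (rZ sZ : Z * Z * Z) (i : nat) :
  close3 r rZ -> close3 s sZ -> dot3 r r <= 102 / 100 -> dot3 s s <= 102 / 100 -> (i < 90)%nat ->
  near2 (37 / 10 ^ 7) (proj_rows r s (vert i)) (approx2 (projZ rZ sZ i)).
Proof. intros; split; apply row_near; auto. Qed.

Definition bounded2 (b : R) (p : pt2) : Prop := Rabs (fst p) <= b /\ Rabs (snd p) <= b.

Lemma proj_bounded (r s : pt3) (i : nat) :
  dot3 r r <= 102 / 100 -> dot3 s s <= 102 / 100 -> (i < 90)%nat ->
  bounded2 (101 / 100) (proj_rows r s (vert i)).
Proof. intros; split; apply row_bounded; auto using vert_ball. Qed.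

Lemma orient_pos (y a b : pt2) (y' a' b' : Z * Z) :
  near2 (38 / 10 ^ 7) y (approx2 y') -> near2 (37 / 10 ^ 7) a (approx2 a') ->
  near2 (37 / 10 ^ 7) b (approx2 b') ->
  bounded2 (102 / 100) y -> bounded2 (101 / 100) a -> bounded2 (101 / 100) b ->
  (10 ^ 20 <=? orientZ y' a' b')%Z = true -> 0 < orient y a b.
Proof.
  destruct y as [y1 y2], a as [a1 a2], b as [b1 b2], y' as [y1' y2'], a' as [a1' a2'], b' as [b1' b2'].
  unfold near2, bounded2, approx2, orient, orientZ; cbn [fst snd].
  intros [Y1 Y2] [A1 A2] [B1 B2] [Y3 Y4] [A3 A4] [B3 B4] H.
  apply Z.leb_le, IZR_le in H. rewrite !minus_IZR, !mult_IZR, !minus_IZR in H.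
  change (10 ^ 20)%Z with 100000000000000000000%Z in H.
  set (u1 := IZR y1' / 10 ^ 12) in *. set (u2 := IZR y2' / 10 ^ 12) in *.
  set (v1 := IZR a1' / 10 ^ 12) in *. set (v2 := IZR a2' / 10 ^ 12) in *.
  set (w1 := IZR b1' / 10 ^ 12) in *. set (w2 := IZR b2' / 10 ^ 12) in *.
  assert (HZ : / 10 ^ 4 <= (v1 - u1) * (w2 - u2) - (v2 - u2) * (w1 - u1)).
  { unfold u1, u2, v1, v2, w1, w2.
    match goal with |- _ <= ?e => replace e with
      (((IZR a1' - IZR y1') * (IZR b2' - IZR y2') - (IZR a2' - IZR y2') * (IZR b1' - IZR y1'))
        / 10 ^ 24) by field end. lra. }
  clearbody u1 u2 v1 v2 w1 w2. clear H.
  apply Rabs_le_between in Y1, Y2, A1, A2, B1, B2, Y3, Y4, A3, A4, B3, B4.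
  (* An orientation is a difference of two such products, so its error is at most [8 / 10 ^ 5],
     below the margin [/ 10 ^ 4]. *)
  assert (D : forall p q p' q' x x' z z', -38 / 10 ^ 7 <= x - x' <= 38 / 10 ^ 7 ->
    -38 / 10 ^ 7 <= z - z' <= 38 / 10 ^ 7 -> -37 / 10 ^ 7 <= p - p' <= 37 / 10 ^ 7 ->
    -37 / 10 ^ 7 <= q - q' <= 37 / 10 ^ 7 -> -(102 / 100) <= x <= 102 / 100 ->
    -(102 / 100) <= z <= 102 / 100 -> -(101 / 100) <= p <= 101 / 100 ->
    -(101 / 100) <= q <= 101 / 100 ->
    Rabs ((p - x) * (q - z) - (p' - x') * (q' - z')) <= 4 / 10 ^ 5).
  { intros.
    assert (E1 : Rabs (p - x - (p' - x')) <= 75 / 10 ^ 7) by (apply Rabs_le; lra).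
    assert (E2 : Rabs (q - z - (q' - z')) <= 75 / 10 ^ 7) by (apply Rabs_le; lra).
    assert (E3 : Rabs (p' - x') <= 204 / 100) by (apply Rabs_le; lra).
    assert (E4 : Rabs (q - z) <= 204 / 100) by (apply Rabs_le; lra).
    pose proof (approx_mul _ _ _ _ _ _ _ _ E1 E2 E3 E4). lra. }
  assert (D1 := D a1 b2 v1 w2 y1 u1 y2 u2 ltac:(lra) ltac:(lra) ltac:(lra) ltac:(lra)
    ltac:(lra) ltac:(lra) ltac:(lra) ltac:(lra)).
  assert (D2 := D a2 b1 v2 w1 y2 u2 y1 u1 ltac:(lra) ltac:(lra) ltac:(lra) ltac:(lra)
    ltac:(lra) ltac:(lra) ltac:(lra) ltac:(lra)).
  apply Rabs_le_between in D1, D2. lra.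
Qed.

Lemma fan_check_sound (r s r' s' : pt3) (rZ sZ rZ' sZ' : Z * Z * Z) (k : nat) (l : list nat) (p : pt3) :
  close3 r rZ -> close3 s sZ -> close3 r' rZ' -> close3 s' sZ' ->
  dot3 r r <= 102 / 100 -> dot3 s s <= 102 / 100 ->
  dot3 r' r' <= 102 / 100 -> dot3 s' s' <= 102 / 100 ->
  (k < 90)%nat -> List.Forall (fun j => j < 90)%nat l ->
  fan_check rZ sZ rZ' sZ' k l = true ->
  In p Ruperthedron -> in_int_conv (map (proj_rows r' s') Ruperthedron) (proj_rows r s p).
Proof.
  intros Cr Cs Cr' Cs' Nr Ns Nr' Ns' Hk Hl H Hp.
  apply in_vert in Hp as (i & Hi & ->).
  unfold fan_check in H. rewrite forallb_forall in H.
  specialize (H i ltac:(apply in_seq; lia)). cbv zeta in H.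
  apply existsb_exists in H as ([m n] & Hmn & H). cbn [fst snd] in H.
  rewrite Forall_forall in Hl.
  assert (Hm : (m < 90)%nat) by (apply Hl; eapply in_combine_l; eauto).
  assert (Hn : (n < 90)%nat).
  { apply Hl. apply in_combine_r in Hmn. destruct l; [destruct Hmn | now right]. }
  unfold triangle_check in H.
  apply andb_prop in H as [H H3]. apply andb_prop in H as [H1 H2].
  destruct (proj_near r s rZ sZ i Cr Cs Nr Ns Hi) as [N1 N2].
  destruct (proj_bounded r s i Nr Ns Hi) as [B1 B2].
  (* This radius is the difference between the tolerance [38 / 10 ^ 7] that [orient_pos] allows for
     [y] and the error [37 / 10 ^ 7] of a projected vertex. *)
  exists (/ 10 ^ 7). split; [lra|]. intros [y1 y2] Hy.
  set (x := proj_rows r s (vert i)) in *. destruct x as [x1 x2]. cbn [fst snd] in *.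
  assert (D1 : - / 10 ^ 7 <= y1 - x1 <= / 10 ^ 7).
  { pose proof (pow2_ge_0 (y2 - x2)). split; nra. }
  assert (D2 : - / 10 ^ 7 <= y2 - x2 <= / 10 ^ 7).
  { pose proof (pow2_ge_0 (y1 - x1)). split; nra. }
  assert (Ny : near2 (38 / 10 ^ 7) (y1, y2) (approx2 (projZ rZ sZ i))).
  { apply Rabs_le_between in N1, N2. split; cbn [fst snd]; apply Rabs_le; lra. }
  assert (By : bounded2 (102 / 100) (y1, y2)).
  { apply Rabs_le_between in B1, B2. split; cbn [fst snd]; apply Rabs_le; lra. }
  apply triangle_in_conv with (proj_rows r' s' (vert k)) (proj_rows r' s' (vert m))
    (proj_rows r' s' (vert n)); auto using in_map, vert_in.
  - eapply orient_pos; eauto using proj_near, proj_bounded.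
  - eapply orient_pos; eauto using proj_near, proj_bounded.
  - eapply orient_pos; eauto using proj_near, proj_bounded.
Qed.

Lemma Ruperthedron_passage :
  exists th1 ph1 th2 ph2 a, param_range th1 ph1 th2 ph2 a /\
    rupert_cond Ruperthedron (1003 / 1000) th1 ph1 th2 ph2 a.
Proof.
  destruct (tan_half_angle (27 / 200)) as (th1 & T1 & C1 & S1); [lra|].
  destruct (tan_half_angle (29 / 200)) as (ph1 & P1 & C2 & S2); [lra|].
  destruct (tan_half_angle (3 / 200)) as (th2 & T2 & C3 & S3); [lra|].
  destruct (tan_half_angle (419 / 200)) as (ph2 & P2 & C4 & S4); [lra|].
  destruct (tan_half_angle (44 / 25)) as (a & A & C5 & S5); [lra|].
  exists th1, ph1, th2, ph2, a. split.
  { unfold param_range. lra. }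
  set (r := (1003 / 1000 * (- cos a * sin th1 + sin a * cos th1 * cos ph1),
             1003 / 1000 * (cos a * cos th1 + sin a * sin th1 * cos ph1),
             1003 / 1000 * (- sin a * sin ph1)) : pt3).
  set (s := (1003 / 1000 * (- sin a * sin th1 - cos a * cos th1 * cos ph1),
             1003 / 1000 * (sin a * cos th1 - cos a * sin th1 * cos ph1),
             1003 / 1000 * (cos a * sin ph1)) : pt3).
  set (r' := (- sin th2, cos th2, 0) : pt3).
  set (s' := (- cos th2 * cos ph2, - sin th2 * cos ph2, sin ph2) : pt3).
  assert (E : forall p, scale2 (1003 / 1000) (Rot a (Mproj th1 ph1 p)) = proj_rows r s p).
  { intros [[x y] z]. unfold scale2, Rot, Mproj, proj_rows, r, s, dot3. f_equal; ring. }
  assert (E' : forall p, Mproj th2 ph2 p = proj_rows r' s' p).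
  { intros [[x y] z]. unfold Mproj, proj_rows, r', s', dot3. f_equal; ring. }
  intros p Hp. rewrite E, (map_ext _ _ E').
  (* The triples are the four rows multiplied by [10 ^ 6] and rounded. Vertex 82 followed by the
     list forms a 22-gon; antipodal vertices have indices [2 m] and [2 m + 1], and from 83 on the
     list repeats the first eleven vertices with reversed signs. *)
  apply (fan_check_sound r s r' s' (932707, -276002, -244723)%Z (246204, 961314, -145833)%Z
    (-29993, 999550, 0)%Z (628592, 18862, 777506)%Z 82
    [67; 35; 33; 5; 3; 1; 29; 27; 55; 53; 83; 66; 34; 32; 4; 2; 0; 28; 26; 54; 52]%nat).
  - unfold r, close3. rewrite C1, S1, C2, S2, C5, S5. repeat split; apply Rabs_le; lra.
  - unfold s, close3. rewrite C1, S1, C2, S2, C5, S5. repeat split; apply Rabs_le; lra.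
  - unfold r', close3. rewrite C3, S3. repeat split; apply Rabs_le; lra.
  - unfold s', close3. rewrite C3, S3, C4, S4. repeat split; apply Rabs_le; lra.
  - unfold r, dot3. rewrite C1, S1, C2, S2, C5, S5. lra.
  - unfold s, dot3. rewrite C1, S1, C2, S2, C5, S5. lra.
  - unfold r', dot3. rewrite C3, S3. lra.
  - unfold s', dot3. rewrite C3, S3, C4, S4. lra.
  - lia.
  - repeat constructor.
  - vm_compute; reflexivity.
  - exact Hp.
Qed.

Theorem theorem8p2 :
  (has_rupert_property Ruperthedron /\
   Rbar_le (Finite (1003 / 1000)) (nieuwland_number Ruperthedron)) /\
  ~ (exists th1 ph1 th2 ph2 a : R,
       Rabs (th1 - th2) <= 6 / 10000 /\ Rabs (ph1 - ph2) <= 6 / 10000 /\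
       Rabs a <= 6 / 10000 /\ rupert_cond Ruperthedron 1 th1 ph1 th2 ph2 a) /\
  (has_rupert_property Ruperthedron /\ ~ locally_rupert Ruperthedron).
Proof.
  assert (Hrupert : has_rupert_property Ruperthedron).
  { destruct Ruperthedron_passage as (th1 & ph1 & th2 & ph2 & a & Hrange & H).
    exists th1, ph1, th2, ph2, a. split; [exact Hrange|].
    apply (rupert_cond_shrink _ (1003 / 1000)); auto using Ruperthedron_neg3; lra. }
  split; [split; [exact Hrupert|] | split; [|split; [exact Hrupert|]]].
  - unfold nieuwland_number.
    match goal with |- Rbar_le _ (Lub_Rbar ?S) => apply (proj1 (Lub_Rbar_correct S)) end.
    split; [lra | exact Ruperthedron_passage].
  - intros (th1 & ph1 & th2 & ph2 & a & Ht & Hp & Ha & H).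
    exact (Ruperthedron_rigid _ _ _ _ _ Ht Hp Ha H).
  - intro H. destruct (H (6 / 10000) ltac:(lra)) as (th1 & ph1 & th2 & ph2 & a & _ & HR & Ht & Hp & Ha).
    exact (Ruperthedron_rigid _ _ _ _ _ Ht Hp Ha HR).
Qed.
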